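(* Let $(S,\mathcal F)$ be a sheaved space with values in $\mathcal V$, and let $s\in S$ be such that $|S_{<s}|$ has the integral homology of a point, i.e. $H_0(|S_{<s}|,\mathbb Z)\cong\mathbb Z$ and $H_i(|S_{<s}|,\mathbb Z)=0$ for $i>0$. Let $S'=S\setminus\{s\}$ with the induced order. Then $$H^{j}(X_S,\mathcal F)\;\cong\; H^{j}(X_{S'},\mathcal F|_{S'})\qquad\text{for all } j\ge 0.$$
   Context: $\mathcal V$ is an abelian category with enough injectives (e.g. abelian groups, or vector spaces over a field). For a finite poset $S$, $X_S$ denotes $S$ with the Alexandrov topology, whose open sets are the upper sets. Sheaves on $X_S$ with values in $\mathcal V$ are identified with functors $\mathcal F: S\to\mathcal V$ (an object $\mathcal F(s)$ for each $s\in S$ and compatible restriction morphisms $\mathcal F(s)\to\mathcal F(t)$ for $s\le t$). A sheaved space is a pair $(S,\mathcal F)$ with $S$ a finite poset and $\mathcal F$ such a sheaf. For $S'\subseteq S$ with the induced order, $\mathcal F|_{S'}$ is the restriction of the functor $\mathcal F$ to $S'$. Global sections are $\Gamma(S,\mathcal F)=\lim_{s\in S}\mathcal F(s)$, and $H^j(X_S,\mathcal F)$ is the $j$-th right derived functor of $\Gamma(S,-)$ applied to $\mathcal F$. For $s\in S$, $S_{<s}=\{v\in S: v<s\}$ with the induced order. For a finite poset $P$, $|P|$ denotes the geometric realization of its order complex (the simplicial complex whose simplices are the nonempty chains of $P$). *)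

(* Defs.v *)
From HB Require Import structures.
From mathcomp Require Import all_boot all_order all_algebra.
From mathcomp Require Import all_classical reals topology normedtype.
From mathcomp Require Import freeg.

Set Implicit Arguments.
Unset Strict Implicit.
Unset Printing Implicit Defensive.

Import Order.TTheory GRing.Theory Num.Theory.
Import numFieldNormedType.Exports.
Local Open Scope classical_set_scope.
Local Open Scope ring_scope.

Section Homology.
Variables (C : nat -> zmodType) (d : forall n, {additive C n.+1 -> C n}).

Definition is_cycle (n : nat) : C n -> Prop :=
  match n return C n -> Prop with
  | 0 => fun=> True
  | m.+1 => fun c => d m c = 0
  end.

Definition cycle_pred (n : nat) : {pred C n} := fun c => `[< is_cycle c >].

Lemma cycle_pred_closed n : zmod_closed (@cycle_pred n).
Proof.
split=> [|x y]; rewrite !unfold_in.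
  by apply/asboolP; case: n => //= m; rewrite raddf0.
move=> /asboolP hx /asboolP hy; apply/asboolP.
by case: n x y hx hy => //= m x y hx hy; rewrite raddfB hx hy subr0.
Qed.

HB.instance Definition _ n :=
  GRing.isZmodClosed.Build (C n) (@cycle_pred n) (cycle_pred_closed n).

Record cycles (n : nat) := Cycle {
  cycle_val : C n;
  cycle_valP : cycle_val \in @cycle_pred n
}.

HB.instance Definition _ n := [isSub for @cycle_val n].
HB.instance Definition _ n := [Choice of cycles n by <:].
HB.instance Definition _ n := [SubChoice_isSubZmodule of cycles n by <:].

Definition boundary_pred (n : nat) : {pred cycles n} :=
  fun c => `[< exists b : C n.+1, d n b = val c >].

Lemma boundary_pred_closed n : zmod_closed (@boundary_pred n).
Proof.
split=> [|x y]; rewrite !unfold_in.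
  by apply/asboolP; exists 0; rewrite raddf0 raddf0.
move=> /asboolP[a ha] /asboolP[b hb]; apply/asboolP; exists (a - b).
by rewrite !raddfB /= ha hb.
Qed.

HB.instance Definition _ n :=
  GRing.isZmodClosed.Build (cycles n) (@boundary_pred n)
    (boundary_pred_closed n).

Definition homology (n : nat) : zmodType := Quotient.quot (@boundary_pred n).

End Homology.

Section Singular.
Variable R : realType.

Definition simplex_set (T : finType) : set {ptws T -> R} :=
  [set x | (forall v, 0 <= x v) /\ \sum_v x v = 1].

(* The realization of a finite simplicial complex, given by its set of
   nonempty faces, in barycentric coordinates; as T is finite, the subspace
   topology inherited from R^T is the usual (coherent) one. *)
Definition realization_set (T : finType) (K : {set {set T}}) : set {ptws T -> R} :=
  [set x | simplex_set x /\ [set v | x v != 0]%SET \in K].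

Definition realization (T : finType) (K : {set {set T}}) : topologicalType :=
  set_type (realization_set K).

Definition std_simplex (n : nat) : topologicalType :=
  set_type (@simplex_set 'I_n.+1).

Definition coface_fun (n : nat) (i : 'I_n.+2) (x : 'I_n.+1 -> R) :
  'I_n.+2 -> R := fun j => if unlift i j is Some k then x k else 0.

Lemma coface_simplex n (i : 'I_n.+2) (x : std_simplex n) :
  coface_fun i (val x) \in @simplex_set 'I_n.+2.
Proof.
case: x => x /= /set_mem [x0 x1]; apply/mem_set; split=> [j|].
  by rewrite /coface_fun; case: unlift.
rewrite (bigD1_ord i) //= /coface_fun unlift_none add0r -x1.
by apply: eq_bigr => k _; rewrite liftK.
Qed.

Definition coface n (i : 'I_n.+2) (x : std_simplex n) : std_simplex n.+1 :=
  exist _ (coface_fun i (val x)) (coface_simplex i x).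

Lemma coface_continuous n (i : 'I_n.+2) : continuous (@coface n i).
Proof.
apply: continuous_comp_initial => x; apply/cvg_sup.
  exact/fmap_filter/nbhs_filter.
move=> j; move: x; apply/(@continuousP _ (initial_topology (@^~ j))).
move=> A [B oB <-].
have -> : (set_val \o coface i) @^-1` ((@^~ j) @^-1` B) =
  (fun x : std_simplex n => coface_fun i (val x) j) @^-1` B by [].
move: B oB; apply/continuousP; rewrite /coface_fun.
case: unlift => [k|]; last exact: cst_continuous.
have cv : continuous (set_val : std_simplex n -> {ptws 'I_n.+1 -> R}).
  exact: initial_continuous.
have cp := @proj_continuous _ (fun=> R : topologicalType) k.
move=> x; exact: (@continuous_comp _ {ptws 'I_n.+1 -> R} _ _ _ x (cv x) (cp _)).
Qed.

HB.instance Definition _ n (i : 'I_n.+2) :=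
  isContinuous.Build _ _ (@coface n i) (@coface_continuous n i).

Section Space.
Variable X : topologicalType.

Definition sing_simplex (n : nat) := continuousType (std_simplex n) X.

Definition sing_chain (n : nat) : zmodType := {freeg (sing_simplex n) / int}.

Definition face n (i : 'I_n.+2) (s : sing_simplex n.+1) : sing_simplex n :=
  s \o coface i.

Definition sing_boundary n : sing_chain n.+1 -> sing_chain n :=
  fglift (fun s => \sum_(i < n.+2) (-1) ^+ i *: << face i s >>).

HB.instance Definition _ n :=
  GRing.isAdditive.Build (sing_chain n.+1) (sing_chain n) (@sing_boundary n)
    (lift_is_additive _).

Definition sing_homology (n : nat) : zmodType :=
  homology (fun m => @sing_boundary m : {additive _ -> _}) n.

Definition has_homology_of_point : Prop :=
  (exists f : {additive sing_homology 0 -> int}, bijective f) /\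
  (forall i, (0 < i)%N -> forall x : sing_homology i, x = 0).

End Space.
End Singular.

Section Poset.
Context {d : Order.disp_t}.

Definition order_complex (P : finPOrderType d) : {set {set P}} :=
  [set c : {set P} |
    (c != finset.set0) && [forall x in c, forall y in c, (x >=< y)%O]]%SET.

Definition poset_realization (R : realType) (P : finPOrderType d) :
  topologicalType := realization R (order_complex P).

Variables (S : finPOrderType d) (A : {set S}).

Record subposet := Subposet { sub_elt :> S; sub_eltP : sub_elt \in A }.

HB.instance Definition _ := [isSub for sub_elt].
HB.instance Definition _ := [Finite of subposet by <:].
HB.instance Definition _ := [SubChoice_isSubPOrder of subposet by <: with d].

End Poset.

Record preadditiveCat := Preadditive {
  ob :> Type;
  hom : ob -> ob -> zmodType;
  idm : forall X, hom X X;
  cmp : forall X Y Z, hom Y Z -> hom X Y -> hom X Z;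
  cmp1m : forall X Y (f : hom X Y), cmp (idm Y) f = f;
  cmpm1 : forall X Y (f : hom X Y), cmp f (idm X) = f;
  cmpA : forall X Y Z W (h : hom Z W) (g : hom Y Z) (f : hom X Y),
    cmp h (cmp g f) = cmp (cmp h g) f;
  cmpDl : forall X Y Z (g g' : hom Y Z) (f : hom X Y),
    cmp (g + g') f = cmp g f + cmp g' f;
  cmpDr : forall X Y Z (g : hom Y Z) (f f' : hom X Y),
    cmp g (f + f') = cmp g f + cmp g f'
}.

Arguments hom {p} X Y.
Arguments idm {p} X.

Notation "g \oc f" := (cmp g f) (at level 40, left associativity).

Section Preadditive.
Variable V : preadditiveCat.
Implicit Types X Y Z : V.

Lemma cmp0m X Y Z (f : hom X Y) : (0 : hom Y Z) \oc f = 0.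
Proof. by apply: (addrI (0 \oc f)); rewrite -cmpDl !addr0. Qed.

Lemma cmpm0 X Y Z (g : hom Y Z) : g \oc (0 : hom X Y) = 0.
Proof. by apply: (addrI (g \oc 0)); rewrite -cmpDr !addr0. Qed.

Lemma cmpNm X Y Z (g : hom Y Z) (f : hom X Y) : (- g) \oc f = - (g \oc f).
Proof. by apply: (addrI (g \oc f)); rewrite -cmpDl !subrr cmp0m. Qed.

Lemma cmpmN X Y Z (g : hom Y Z) (f : hom X Y) : g \oc (- f) = - (g \oc f).
Proof. by apply: (addrI (g \oc f)); rewrite -cmpDr !subrr cmpm0. Qed.

Lemma cmpBl X Y Z (g g' : hom Y Z) (f : hom X Y) :
  (g - g') \oc f = g \oc f - g' \oc f.
Proof. by rewrite cmpDl cmpNm. Qed.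

Lemma cmpBr X Y Z (g : hom Y Z) (f f' : hom X Y) :
  g \oc (f - f') = g \oc f - g \oc f'.
Proof. by rewrite cmpDr cmpmN. Qed.

Definition isomorphic X Y : Prop :=
  exists (f : hom X Y) (g : hom Y X), g \oc f = idm X /\ f \oc g = idm Y.

Definition mono X Y (f : hom X Y) : Prop :=
  forall Z (u v : hom Z X), f \oc u = f \oc v -> u = v.

Definition epi X Y (f : hom X Y) : Prop :=
  forall Z (u v : hom Y Z), u \oc f = v \oc f -> u = v.

Definition is_zero Z : Prop :=
  forall X, (forall f : hom X Z, f = 0) /\ (forall f : hom Z X, f = 0).

Definition is_kernel X Y (f : hom X Y) K (k : hom K X) : Prop :=
  f \oc k = 0 /\
  forall Z (u : hom Z X), f \oc u = 0 -> exists! v : hom Z K, k \oc v = u.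

Definition is_cokernel X Y (f : hom X Y) C (c : hom Y C) : Prop :=
  c \oc f = 0 /\
  forall Z (u : hom Y Z), u \oc f = 0 -> exists! v : hom C Z, v \oc c = u.

Definition is_biproduct X Y B (i1 : hom X B) (i2 : hom Y B)
    (p1 : hom B X) (p2 : hom B Y) : Prop :=
  [/\ p1 \oc i1 = idm X, p2 \oc i2 = idm Y, p1 \oc i2 = 0, p2 \oc i1 = 0
    & i1 \oc p1 + i2 \oc p2 = idm B].

Record is_abelian : Prop := IsAbelian {
  ab_zero : exists Z, is_zero Z;
  ab_biproduct : forall X Y, exists B i1 i2 p1 p2,
    @is_biproduct X Y B i1 i2 p1 p2;
  ab_kernel : forall X Y (f : hom X Y), exists K (k : hom K X), is_kernel f k;
  ab_cokernel : forall X Y (f : hom X Y), exists C (c : hom Y C),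
    is_cokernel f c;
  ab_mono : forall X Y (f : hom X Y), mono f ->
    exists Z (g : hom Y Z), is_kernel g f;
  ab_epi : forall X Y (f : hom X Y), epi f ->
    exists Z (g : hom Z X), is_cokernel g f
}.

Definition injective_object I : Prop :=
  forall X Y (m : hom X Y), mono m ->
  forall f : hom X I, exists g : hom Y I, g \oc m = f.

Definition enough_injectives : Prop :=
  forall X, exists I (m : hom X I), injective_object I /\ mono m.

(* Exactness of X -f-> Y -g-> Z at Y: f is an epimorphism onto a kernel of g. *)
Definition exact X Y Z (f : hom X Y) (g : hom Y Z) : Prop :=
  exists K (k : hom K Y) (u : hom X K), [/\ is_kernel g k, k \oc u = f & epi u].

Lemma mono0P X Y (f : hom X Y) :
  mono f <-> forall Z (u : hom Z X), f \oc u = 0 -> u = 0.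
Proof.
split=> [mf Z u fu|H Z u v fuv].
  by apply: mf; rewrite fu cmpm0.
by apply/eqP; rewrite -subr_eq0; apply/eqP/H; rewrite cmpBr fuv subrr.
Qed.

Lemma epi0P X Y (f : hom X Y) :
  epi f <-> forall Z (u : hom Y Z), u \oc f = 0 -> u = 0.
Proof.
split=> [ef Z u uf|H Z u v uvf].
  by apply: ef; rewrite uf cmp0m.
by apply/eqP; rewrite -subr_eq0; apply/eqP/H; rewrite cmpBl uvf subrr.
Qed.

Lemma kernel_mono X Y (f : hom X Y) K (k : hom K X) : is_kernel f k -> mono k.
Proof.
move=> [fk ku]; apply/mono0P => Z u ku0.
have [v [_ vu]] := ku Z 0 (cmpm0 _ _).
by rewrite -(vu u ku0) -(vu 0 (cmpm0 _ _)).
Qed.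

Lemma cokernel_epi X Y (f : hom X Y) C (c : hom Y C) : is_cokernel f c -> epi c.
Proof.
move=> [cf cu]; apply/epi0P => Z u uc0.
have [v [_ vu]] := cu Z 0 (cmp0m _ _).
by rewrite -(vu u uc0) -(vu 0 (cmp0m _ _)).
Qed.

Lemma mono_kernel_cokernel X Y Z (f : hom X Y) (g : hom Y Z) C (c : hom Y C) :
  is_kernel g f -> is_cokernel f c -> is_kernel c f.
Proof.
move=> [gf fu] [cf cu]; split=> // W u cu0; apply: fu.
by have [v [vc _]] := cu _ g gf; rewrite -vc -cmpA cu0 cmpm0.
Qed.

Lemma epi_cokernel_kernel X Y Z (f : hom X Y) (g : hom Z X) K (k : hom K X) :
  is_cokernel g f -> is_kernel f k -> is_cokernel k f.
Proof.
move=> [fg fu] [fk ku]; split=> // W u uk0; apply: fu.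
by have [v [kv _]] := ku _ g fg; rewrite -kv cmpA uk0 cmp0m.
Qed.

End Preadditive.

Arguments enough_injectives V : clear implicits.

Record abelianCat := Abelian {
  ab_cat :> preadditiveCat;
  abP : is_abelian ab_cat
}.

Section Abelian.
Variable V : abelianCat.
Implicit Types X Y Z : V.

Lemma ker_ex X Y (f : hom X Y) :
  exists K : {K : V & hom K X}, is_kernel f (projT2 K).
Proof.
by have [K [k fk]] := ab_kernel (abP V) f; exists (existT _ K k).
Qed.

Lemma coker_ex X Y (f : hom X Y) :
  exists C : {C : V & hom Y C}, is_cokernel f (projT2 C).
Proof.
by have [C [c fc]] := ab_cokernel (abP V) f; exists (existT _ C c).
Qed.

Definition ker X Y (f : hom X Y) : V := projT1 (projT1 (cid (ker_ex f))).
Definition kerm X Y (f : hom X Y) : hom (ker f) X :=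
  projT2 (projT1 (cid (ker_ex f))).
Lemma kermP X Y (f : hom X Y) : is_kernel f (kerm f).
Proof. exact: projT2 (cid (ker_ex f)). Qed.

Definition coker X Y (f : hom X Y) : V := projT1 (projT1 (cid (coker_ex f))).
Definition cokerm X Y (f : hom X Y) : hom Y (coker f) :=
  projT2 (projT1 (cid (coker_ex f))).
Lemma cokermP X Y (f : hom X Y) : is_cokernel f (cokerm f).
Proof. exact: projT2 (cid (coker_ex f)). Qed.

Lemma ker_lift_ex X Y Z (f : hom X Y) (u : hom Z X) :
  f \oc u = 0 -> exists v, kerm f \oc v = u.
Proof. by move=> fu; have [v [kv _]] := (kermP f).2 _ u fu; exists v. Qed.

Definition ker_lift X Y Z (f : hom X Y) (u : hom Z X) (fu : f \oc u = 0) :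
  hom Z (ker f) := projT1 (cid (ker_lift_ex fu)).

Lemma ker_liftE X Y Z (f : hom X Y) (u : hom Z X) (fu : f \oc u = 0) :
  kerm f \oc ker_lift fu = u.
Proof. exact: projT2 (cid (ker_lift_ex fu)). Qed.

Lemma coker_desc_ex X Y Z (f : hom X Y) (u : hom Y Z) :
  u \oc f = 0 -> exists v, v \oc cokerm f = u.
Proof. by move=> uf; have [v [kv _]] := (cokermP f).2 _ u uf; exists v. Qed.

Definition coker_desc X Y Z (f : hom X Y) (u : hom Y Z) (uf : u \oc f = 0) :
  hom (coker f) Z := projT1 (cid (coker_desc_ex uf)).

Lemma coker_descE X Y Z (f : hom X Y) (u : hom Y Z) (uf : u \oc f = 0) :
  coker_desc uf \oc cokerm f = u.
Proof. exact: projT2 (cid (coker_desc_ex uf)). Qed.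

Lemma exact_cokerm X Y (f : hom X Y) J (m : hom (coker f) J) :
  mono m -> exact f (m \oc cokerm f).
Proof.
move=> mm; set c := cokerm f; pose k := kerm c.
have cf : c \oc f = 0 := (cokermP f).1.
exists (ker c), k, (ker_lift cf); split; last 1 first.
- apply/epi0P => Z h hu.
  pose l := kerm h; pose u' := ker_lift hu.
  have mkl : mono (k \oc l).
    apply/mono0P => W w; rewrite -cmpA => klw.
    move/mono0P: (kernel_mono (kermP c)) => /(_ _ _ klw) lw.
    by move/mono0P: (kernel_mono (kermP h)) => /(_ _ _ lw).
  have [W [q kq]] := ab_mono (abP V) mkl.
  have qf : q \oc f = 0.
    by rewrite -(ker_liftE cf) -(ker_liftE hu) (cmpA k) cmpA kq.1 cmp0m.
  have qk : q \oc k = 0.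
    by rewrite -(coker_descE qf) -cmpA (kermP c).1 cmpm0.
  have [v [klv _]] := kq.2 _ _ qk.
  have lv : l \oc v = idm _.
    by apply: (kernel_mono (kermP c)); rewrite cmpm1 cmpA.
  by rewrite -(cmpm1 h) -lv cmpA (kermP h).1 cmp0m.
- split=> [|Z u]; first by rewrite -cmpA (kermP c).1 cmpm0.
  rewrite -cmpA => mcu; apply: (kermP c).2.
  by move/mono0P: mm; apply.
- exact: ker_liftE.
Qed.

Record cochain_complex := CochainComplex {
  cobj :> nat -> V;
  cdiff : forall n, hom (cobj n) (cobj n.+1);
  cdiffK : forall n, cdiff n.+1 \oc cdiff n = 0
}.

(* With the convention C^-1 = 0. *)
Definition cohomology (C : cochain_complex) (n : nat) : V :=
  match n with
  | 0 => ker (cdiff C 0)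
  | m.+1 => coker (ker_lift (cdiffK C m))
  end.

Record injective_resolution X := InjectiveResolution {
  ir_complex :> cochain_complex;
  ir_aug : hom X (ir_complex 0);
  ir_inj : forall n, injective_object (ir_complex n);
  ir_mono : mono ir_aug;
  ir_exact0 : exact ir_aug (cdiff ir_complex 0);
  ir_exact : forall n, exact (cdiff ir_complex n) (cdiff ir_complex n.+1)
}.

Lemma exact_cmp X Y Z (f : hom X Y) (g : hom Y Z) : exact f g -> g \oc f = 0.
Proof. by move=> [K [k [u [kk <- _]]]]; rewrite cmpA kk.1 cmp0m. Qed.

Section Existence.
Hypothesis ei : enough_injectives V.

Lemma inj_hull_ex X : exists J : {J : V & hom X J},
  injective_object (projT1 J) /\ mono (projT2 J).
Proof. by have [J [m Jm]] := ei X; exists (existT _ J m). Qed.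

Let hull X := projT1 (projT1 (cid (inj_hull_ex X))).
Let hullm X : hom X (hull X) := projT2 (projT1 (cid (inj_hull_ex X))).
Let hullP X : injective_object (hull X) /\ mono (hullm X).
Proof. exact: projT2 (cid (inj_hull_ex X)). Qed.

Let arrow := {p : V * V & hom p.1 p.2}.
Let step (a : arrow) : arrow :=
  existT (fun p : V * V => hom p.1 p.2)
    ((projT1 a).2, hull (coker (projT2 a)))
    (hullm _ \oc cokerm (projT2 a)).
Let arrows X (n : nat) : arrow :=
  iter n step (existT (fun p : V * V => hom p.1 p.2) (X, hull X) (hullm X)).

Let arrows_exact X n :
  exact (projT2 (arrows X n)) (projT2 (arrows X n.+1)).
Proof. exact/exact_cokerm/(hullP _).2. Qed.

Lemma injective_resolution_ex X : exists _ : injective_resolution X, True.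
Proof.
pose C := @CochainComplex (fun n => (projT1 (arrows X n)).2)
  (fun n => projT2 (arrows X n.+1)) (fun n => exact_cmp (arrows_exact X n.+1)).
suff iC n : injective_object (C n).
  exists (@InjectiveResolution X C (hullm X) iC (hullP X).2
    (arrows_exact X 0) (fun n => arrows_exact X n.+1)); exact: I.
by case: n => [|n]; exact: (hullP _).1.
Qed.

Definition inj_resolution X : injective_resolution X :=
  projT1 (cid (injective_resolution_ex X)).

End Existence.
End Abelian.

Record additive_functor (A B : preadditiveCat) := AdditiveFunctor {
  fob :> A -> B;
  fmap : forall X Y : A, hom X Y -> hom (fob X) (fob Y);
  fmap1 : forall X, fmap (idm X) = idm (fob X);
  fmapM : forall X Y Z (g : hom Y Z) (f : hom X Y),
    fmap (g \oc f) = fmap g \oc fmap f;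
  fmapD : forall X Y (f g : hom X Y), fmap (f + g) = fmap f + fmap g
}.

Section Derived.
Variables (A B : abelianCat) (T : additive_functor A B).

Lemma fmap0 X Y : fmap T (0 : hom X Y) = 0.
Proof. by apply: (addrI (fmap T 0)); rewrite -fmapD !addr0. Qed.

Lemma map_complex_subproof (C : cochain_complex A) n :
  fmap T (cdiff C n.+1) \oc fmap T (cdiff C n) = 0.
Proof. by rewrite -fmapM cdiffK fmap0. Qed.

Definition map_complex (C : cochain_complex A) : cochain_complex B :=
  CochainComplex (map_complex_subproof C).

Definition right_derived (ei : enough_injectives A) (j : nat) (X : A) : B :=
  cohomology (map_complex (inj_resolution ei X)) j.

End Derived.

Section Sheaves.
Context {d : Order.disp_t}.
Variables (S : finPOrderType d) (V : preadditiveCat).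

(* Under the identification of V-valued sheaves on the Alexandrov space X_S
   (opens are the upper sets) with functors S -> V, the value at s is the stalk
   at s, i.e. the sections over the least open neighbourhood of s. *)
Record sheaf := Sheaf {
  stalk :> S -> V;
  res : forall s t : S, (s <= t)%O -> hom (stalk s) (stalk t);
  res1 : forall s (h : (s <= s)%O), res h = idm (stalk s);
  resM : forall s t u (h : (s <= t)%O) (k : (t <= u)%O) (l : (s <= u)%O),
    res k \oc res h = res l
}.

Record sheaf_hom (F G : sheaf) := SheafHom {
  sapp :> forall s, hom (F s) (G s);
  sappE : forall s t (h : (s <= t)%O),
    sapp t \oc res F h = res G h \oc sapp s
}.

Lemma sheaf_homP (F G : sheaf) (f g : sheaf_hom F G) :
  (forall s, f s = g s) -> f = g.
Proof.
case: f g => [f hf] [g hg] /= /(@functional_extensionality_dep _ _ f g) fg.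
by case: _ / fg hg => hg; congr SheafHom; exact: Prop_irrelevance.
Qed.

HB.instance Definition _ F G := gen_eqMixin (sheaf_hom F G).
HB.instance Definition _ F G := gen_choiceMixin (sheaf_hom F G).

Section HomGroup.
Variables F G : sheaf.

Fact shom0_subproof s t (h : (s <= t)%O) :
  (0 : hom (F t) (G t)) \oc res F h = res G h \oc 0.
Proof. by rewrite cmp0m cmpm0. Qed.
Definition shom0 : sheaf_hom F G := SheafHom shom0_subproof.

Fact shomN_subproof (f : sheaf_hom F G) s t (h : (s <= t)%O) :
  (- f t) \oc res F h = res G h \oc (- f s).
Proof. by rewrite cmpNm cmpmN sappE. Qed.
Definition shomN (f : sheaf_hom F G) : sheaf_hom F G :=
  SheafHom (@shomN_subproof f).

Fact shomD_subproof (f g : sheaf_hom F G) s t (h : (s <= t)%O) :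
  (f t + g t) \oc res F h = res G h \oc (f s + g s).
Proof. by rewrite cmpDl cmpDr !sappE. Qed.
Definition shomD (f g : sheaf_hom F G) : sheaf_hom F G :=
  SheafHom (@shomD_subproof f g).

Fact shomDA : associative shomD.
Proof. by move=> f g h; apply: sheaf_homP => s /=; rewrite addrA. Qed.
Fact shomDC : commutative shomD.
Proof. by move=> f g; apply: sheaf_homP => s /=; rewrite addrC. Qed.
Fact shom0D : left_id shom0 shomD.
Proof. by move=> f; apply: sheaf_homP => s /=; rewrite add0r. Qed.
Fact shomND : left_inverse shom0 shomN shomD.
Proof. by move=> f; apply: sheaf_homP => s /=; rewrite addNr. Qed.

HB.instance Definition _ :=
  GRing.isZmodule.Build (sheaf_hom F G) shomDA shomDC shom0D shomND.

End HomGroup.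

Fact shom1_subproof (F : sheaf) s t (h : (s <= t)%O) :
  idm (F t) \oc res F h = res F h \oc idm (F s).
Proof. by rewrite cmp1m cmpm1. Qed.
Definition shom1 (F : sheaf) : sheaf_hom F F := SheafHom (@shom1_subproof F).

Fact shomM_subproof (F G H : sheaf) (g : sheaf_hom G H) (f : sheaf_hom F G)
  s t (h : (s <= t)%O) :
  (g t \oc f t) \oc res F h = res H h \oc (g s \oc f s).
Proof. by rewrite -cmpA sappE !cmpA sappE. Qed.
Definition shomM (F G H : sheaf) (g : sheaf_hom G H) (f : sheaf_hom F G) :
  sheaf_hom F H := SheafHom (@shomM_subproof F G H g f).

Definition sheaf_preadditive : preadditiveCat.
Proof.
refine (@Preadditive sheaf (fun F G => sheaf_hom F G : zmodType)
  shom1 shomM _ _ _ _ _).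
- by move=> F G f; apply: sheaf_homP => s; exact: cmp1m.
- by move=> F G f; apply: sheaf_homP => s; exact: cmpm1.
- by move=> *; apply: sheaf_homP => s; exact: cmpA.
- by move=> *; apply: sheaf_homP => s; exact: cmpDl.
- by move=> *; apply: sheaf_homP => s; exact: cmpDr.
Defined.

Definition is_limit (F : sheaf) (L : V) (p : forall s, hom L (F s)) : Prop :=
  (forall s t (h : (s <= t)%O), res F h \oc p s = p t) /\
  forall Z (q : forall s, hom Z (F s)),
    (forall s t (h : (s <= t)%O), res F h \oc q s = q t) ->
    exists! u : hom Z L, forall s, p s \oc u = q s.

End Sheaves.

Section Products.
Variable V : abelianCat.

Lemma seq_product (I : eqType) (X : I -> V) (r : seq I) :
  exists P (p : forall i, hom P (X i)),
    (forall Z (q : forall i, hom Z (X i)), exists u : hom Z P,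
      forall i, i \in r -> p i \oc u = q i) /\
    (forall Z (u v : hom Z P),
      (forall i, i \in r -> p i \oc u = p i \oc v) -> u = v).
Proof.
elim: r => [|a r [P [p [pex pun]]]].
  have [Z zZ] := ab_zero (abP V).
  exists Z, (fun=> 0); split=> [W q|W u v _]; first by exists 0.
  by rewrite ((zZ W).1 u) ((zZ W).1 v).
have [B [i1 [i2 [p1 [p2 [e11 e22 e12 e21 e]]]]]] :=
  ab_biproduct (abP V) (X a) P.
have [ar|ar] := boolP (a \in r).
  exists P, p; split=> [Z q|Z u v uv].
    have [u uq] := pex Z q; exists u => i.
    by rewrite inE => /predU1P[->|]; exact: uq.
  by apply: pun => i ir; apply: uv; rewrite inE ir orbT.
pose P' i : hom B (X i) :=
  if eqP is ReflectT e in reflect _ b return hom B (X i) then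
    ecast j (hom B (X j)) e p1 else p i \oc p2.
have P'a : P' a = p1.
  by rewrite /P'; case: eqP => // e'; rewrite eq_axiomK.
have P'i i : i \in r -> P' i = p i \oc p2.
  move=> ir; rewrite /P'; case: eqP => // e'; case: _ / e' ir => ir.
  by rewrite ir in ar.
exists B, P'; split=> [Z q|Z u v uv].
  have [u uq] := pex Z q; exists (i1 \oc q a + i2 \oc u) => i.
  rewrite inE => /predU1P[->|ir].
    by rewrite P'a cmpDr !cmpA e11 e12 cmp1m cmp0m addr0.
  by rewrite P'i // -cmpA cmpDr !cmpA e21 e22 cmp1m cmp0m add0r uq.
rewrite -(cmp1m u) -(cmp1m v) -e !cmpDl -!cmpA.
have -> : p1 \oc u = p1 \oc v by rewrite -P'a uv ?mem_head.
have -> // : p2 \oc u = p2 \oc v.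
by apply: pun => i ir; rewrite !cmpA -P'i // uv // inE ir orbT.
Qed.

Lemma fin_product (I : finType) (X : I -> V) :
  exists P (p : forall i, hom P (X i)),
    forall Z (q : forall i, hom Z (X i)),
      exists! u : hom Z P, forall i, p i \oc u = q i.
Proof.
have [P [p [pex pun]]] := seq_product X (enum I).
exists P, p => Z q; have [u uq] := pex Z q; exists u; split=> [i|v vq].
  by rewrite uq ?mem_enum.
by apply: pun => i _; rewrite vq uq ?mem_enum.
Qed.

End Products.

Section SheafCategory.
Context {d : Order.disp_t}.
Variables (S : finPOrderType d) (V : abelianCat).
Local Notation Sh := (sheaf_preadditive S V).
Implicit Types F G H : Sh.

Lemma shomE F G (f g : hom F G) s : f = g -> sapp f s = sapp g s.
Proof. by move=> ->. Qed.

Section Kernel.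
Variables (F G : Sh) (f : hom F G).
Let K s := ker (sapp f s).
Let k s : hom (K s) (F s) := kerm (sapp f s).

Lemma sker_subproof s t (h : (s <= t)%O) : sapp f t \oc (res F h \oc k s) = 0.
Proof. by rewrite cmpA sappE -cmpA (kermP _).1 cmpm0. Qed.

Let kmono s : mono (k s) := kernel_mono (kermP (sapp f s)).

Definition sker : Sh.
Proof.
refine (@Sheaf _ S V K (fun s t h => ker_lift (sker_subproof h)) _ _).
- by move=> s h; apply: kmono; rewrite ker_liftE res1 cmp1m cmpm1.
- move=> s t u h h' l; apply: kmono.
  by rewrite cmpA !ker_liftE -cmpA ker_liftE cmpA (resM F h h' l).
Defined.

Definition skerm : hom sker F.
Proof.
refine (@SheafHom _ S V sker F k _).
by move=> s t h; rewrite /= ker_liftE.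
Defined.

Lemma skernel_of_pointwise H (i : hom H F) :
  (forall s, is_kernel (sapp f s) (sapp i s)) -> is_kernel f i.
Proof.
move=> iker; split=> [|Z u fu].
  by apply: sheaf_homP => s; exact: (iker s).1.
have fus s : sapp f s \oc sapp u s = 0 by exact: (shomE s fu).
pose v s := projT1 (cid ((iker s).2 _ _ (fus s))).
have vP s : sapp i s \oc v s = sapp u s.
  by rewrite /v; case: cid => w [].
have im s : mono (sapp i s) := kernel_mono (iker s).
have vn s t (h : (s <= t)%O) : v t \oc res Z h = res H h \oc v s.
  by apply: im; rewrite !cmpA vP !sappE -cmpA vP.
exists (SheafHom vn); split=> [|w iw]; first exact: sheaf_homP.
apply: sheaf_homP => s; apply: im; rewrite vP.
by rewrite -(shomE s iw).
Qed.

Lemma skermP : is_kernel f skerm.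
Proof. by apply: skernel_of_pointwise => s; exact: kermP. Qed.

Lemma smonoP : mono f <-> forall s, mono (sapp f s).
Proof.
split=> [fm s|fm].
  have sk0 : skerm = 0.
    by move/mono0P: fm => /(_ _ _ skermP.1).
  apply/mono0P => Z u fu.
  by rewrite -(ker_liftE fu) (shomE s sk0 : kerm (sapp f s) = 0) cmp0m.
move=> Z u v fuv; apply: sheaf_homP => s; apply: fm.
exact: (shomE s fuv).
Qed.

End Kernel.

Section Cokernel.
Variables (F G : Sh) (f : hom F G).
Let C s := coker (sapp f s).
Let c s : hom (G s) (C s) := cokerm (sapp f s).

Lemma scoker_subproof s t (h : (s <= t)%O) :
  (c t \oc res G h) \oc sapp f s = 0.
Proof. by rewrite -cmpA -sappE cmpA (cokermP _).1 cmp0m. Qed.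

Let cepi s : epi (c s) := cokernel_epi (cokermP (sapp f s)).

Definition scoker : Sh.
Proof.
refine (@Sheaf _ S V C (fun s t h => coker_desc (scoker_subproof h)) _ _).
- by move=> s h; apply: cepi; rewrite coker_descE res1 cmp1m cmpm1.
- move=> s t u h h' l; apply: cepi.
  by rewrite -cmpA !coker_descE cmpA coker_descE -cmpA (resM G h h' l).
Defined.

Definition scokerm : hom G scoker.
Proof.
refine (@SheafHom _ S V G scoker c _).
by move=> s t h; rewrite /= coker_descE.
Defined.

Lemma scokernel_of_pointwise H (p : hom G H) :
  (forall s, is_cokernel (sapp f s) (sapp p s)) -> is_cokernel f p.
Proof.
move=> pcok; split=> [|Z u uf].
  by apply: sheaf_homP => s; exact: (pcok s).1.
have ufs s : sapp u s \oc sapp f s = 0 by exact: (shomE s uf).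
pose v s := projT1 (cid ((pcok s).2 _ _ (ufs s))).
have vP s : v s \oc sapp p s = sapp u s.
  by rewrite /v; case: cid => w [].
have pe s : epi (sapp p s) := cokernel_epi (pcok s).
have vn s t (h : (s <= t)%O) : v t \oc res H h = res Z h \oc v s.
  by apply: pe; rewrite -!cmpA vP -!sappE cmpA vP.
exists (SheafHom vn); split=> [|w pw]; first exact: sheaf_homP.
apply: sheaf_homP => s; apply: pe; rewrite vP.
by rewrite -(shomE s pw).
Qed.

Lemma scokermP : is_cokernel f scokerm.
Proof. by apply: scokernel_of_pointwise => s; exact: cokermP. Qed.

Lemma sepiP : epi f <-> forall s, epi (sapp f s).
Proof.
split=> [fe s|fe].
  have sc0 : scokerm = 0.
    by move/epi0P: fe => /(_ _ _ scokermP.1).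
  apply/epi0P => Z u uf.
  by rewrite -(coker_descE uf) (shomE s sc0 : cokerm (sapp f s) = 0) cmpm0.
move=> Z u v uvf; apply: sheaf_homP => s; apply: fe.
exact: (shomE s uvf).
Qed.

End Cokernel.

Lemma szero_ex : exists Z : Sh, is_zero Z.
Proof.
have [Z zZ] := ab_zero (abP V).
have ZZ s t u (f g : hom Z Z) : f = g by rewrite ((zZ Z).1 f) ((zZ Z).1 g).
pose O : Sh := @Sheaf _ S V (fun=> Z) (fun _ _ _ => idm Z)
  (fun _ _ => erefl) (fun _ _ _ _ _ _ => cmp1m _).
by exists O => F; split=> f; apply: sheaf_homP => s;
  [exact: (zZ _).1 | exact: (zZ _).2].
Qed.

Lemma sbiproduct_ex F G : exists B i1 i2 p1 p2,
  @is_biproduct Sh F G B i1 i2 p1 p2.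
Proof.
pose bp s := cid (ab_biproduct (abP V) (F s) (G s)).
pose B s := projT1 (bp s).
have bp1 s := projT2 (bp s); rewrite -/(B _) in bp1.
pose i1 s : hom (F s) (B s) := projT1 (cid (bp1 s)).
have bp2 s := projT2 (cid (bp1 s)); rewrite -/(i1 _) in bp2.
pose i2 s : hom (G s) (B s) := projT1 (cid (bp2 s)).
have bp3 s := projT2 (cid (bp2 s)); rewrite -/(i2 _) in bp3.
pose p1 s : hom (B s) (F s) := projT1 (cid (bp3 s)).
have bp4 s := projT2 (cid (bp3 s)); rewrite -/(p1 _) in bp4.
pose p2 s : hom (B s) (G s) := projT1 (cid (bp4 s)).
have bpP s : is_biproduct (i1 s) (i2 s) (p1 s) (p2 s) := projT2 (cid (bp4 s)).
have e11 s : p1 s \oc i1 s = idm _ by case: (bpP s).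
have e22 s : p2 s \oc i2 s = idm _ by case: (bpP s).
have e12 s : p1 s \oc i2 s = 0 by case: (bpP s).
have e21 s : p2 s \oc i1 s = 0 by case: (bpP s).
have e s : i1 s \oc p1 s + i2 s \oc p2 s = idm _ by case: (bpP s).
pose r s t (h : (s <= t)%O) : hom (B s) (B t) :=
  i1 t \oc res F h \oc p1 s + i2 t \oc res G h \oc p2 s.
have ri1 s t (h : (s <= t)%O) : r s t h \oc i1 s = i1 t \oc res F h.
  by rewrite cmpDl -!cmpA e11 e21 !cmpm0 addr0 cmpm1.
have ri2 s t (h : (s <= t)%O) : r s t h \oc i2 s = i2 t \oc res G h.
  by rewrite cmpDl -!cmpA e22 e12 !cmpm0 add0r cmpm1.
have pr1 s t (h : (s <= t)%O) : p1 t \oc r s t h = res F h \oc p1 s.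
  by rewrite cmpDr !cmpA e11 e12 !cmp0m addr0 cmp1m.
have pr2 s t (h : (s <= t)%O) : p2 t \oc r s t h = res G h \oc p2 s.
  by rewrite cmpDr !cmpA e22 e21 !cmp0m add0r cmp1m.
have r1 s (h : (s <= s)%O) : r s s h = idm (B s).
  by rewrite /r !res1 !cmpm1 e.
have rM s t u (h : (s <= t)%O) (k : (t <= u)%O) (l : (s <= u)%O) :
    r t u k \oc r s t h = r s u l.
  rewrite {2}/r cmpDr !cmpA ri1 ri2 /r -(resM F h k l) -(resM G h k l).
  by rewrite !cmpA.
pose BS : Sh := Sheaf r1 rM.
exists BS, (@SheafHom _ S V F BS i1 (fun s t h => esym (ri1 s t h))),
  (@SheafHom _ S V G BS i2 (fun s t h => esym (ri2 s t h))),
  (@SheafHom _ S V BS F p1 pr1), (@SheafHom _ S V BS G p2 pr2).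
split; apply: sheaf_homP => s;
  [exact: e11|exact: e22|exact: e12|exact: e21|exact: e].
Qed.

Lemma sheaf_is_abelian : is_abelian Sh.
Proof.
split.
- exact: szero_ex.
- exact: sbiproduct_ex.
- by move=> F G f; exists (sker f), (skerm f); exact: skermP.
- by move=> F G f; exists (scoker f), (scokerm f); exact: scokermP.
- move=> F G f fm; exists (scoker f), (scokerm f).
  apply: skernel_of_pointwise => s.
  have [Z [g gf]] := ab_mono (abP V) ((smonoP f).1 fm s).
  exact: mono_kernel_cokernel gf (cokermP _).
- move=> F G f fe; exists (sker f), (skerm f).
  apply: scokernel_of_pointwise => s.
  have [Z [g gf]] := ab_epi (abP V) ((sepiP f).1 fe s).
  exact: epi_cokernel_kernel gf (kermP _).
Qed.

Definition sheaf_abelian : abelianCat := Abelian sheaf_is_abelian.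

(* F embeds into the sheaf t |-> prod_(s >= t) I_s, where I_s is an injective
   object containing F(s). *)
Lemma sheaf_enough_injectives :
  enough_injectives V -> enough_injectives sheaf_abelian.
Proof.
move=> ei F.
pose J s := projT1 (projT1 (cid (inj_hull_ex ei (F s)))).
pose j s : hom (F s) (J s) := projT2 (projT1 (cid (inj_hull_ex ei (F s)))).
have jP s : injective_object (J s) /\ mono (j s).
  exact: projT2 (cid (inj_hull_ex ei (F s))).
pose up t := {s : S | (t <= s)%O}.
pose pr t := cid (fin_product (fun s : up t => J (val s))).
pose P t := projT1 (pr t).
have pr1 t := projT2 (pr t); rewrite -/(P _) in pr1.
pose p0 t : forall s : up t, hom (P t) (J (val s)) := projT1 (cid (pr1 t)).
have p0P t Z (q : forall s : up t, hom Z (J (val s))) :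
    exists! u : hom Z (P t), forall i, p0 t i \oc u = q i.
  exact: (projT2 (cid (pr1 t)) Z q).
pose p t s (h : (t <= s)%O) : hom (P t) (J s) := p0 t (exist _ s h).
have pun t Z (u v : hom Z (P t)) :
    (forall s (h : (t <= s)%O), p t s h \oc u = p t s h \oc v) -> u = v.
  move=> uv; have [w [_ wu]] := p0P t Z (fun s => p0 t s \oc v).
  rewrite -(wu v) // -(wu u) // => -[s h]; exact: uv.
have pex t Z (q : forall s, (t <= s)%O -> hom Z (J s)) :
    exists u : hom Z (P t), forall s h, p t s h \oc u = q s h.
  have [u [uq _]] := p0P t Z (fun s => q (val s) (proj2_sig s)).
  by exists u => s h; exact: (uq (exist _ s h)).
pose r s t (h : (s <= t)%O) : hom (P s) (P t) :=
  projT1 (cid (pex t (P s) (fun u k => p s u (le_trans h k)))).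
have rP s t (h : (s <= t)%O) u (k : (t <= u)%O) (l : (s <= u)%O) :
    p t u k \oc r s t h = p s u l.
  rewrite (projT2 (cid (pex t (P s) (fun u k => p s u (le_trans h k))))).
  congr p; exact: Prop_irrelevance.
have r1 s (h : (s <= s)%O) : r s s h = idm (P s).
  by apply: pun => u k; rewrite (rP _ _ _ _ _ k) cmpm1.
have rM s t u (h : (s <= t)%O) (k : (t <= u)%O) (l : (s <= u)%O) :
    r t u k \oc r s t h = r s u l.
  apply: pun => w m; have tw := le_trans k m; have sw := le_trans l m.
  by rewrite cmpA (rP _ _ _ _ _ tw) (rP _ _ _ _ _ sw) (rP _ _ _ _ _ sw).
pose G : sheaf_abelian := Sheaf r1 rM.
have ext (A : Sh) (q : forall s, hom (A s) (J s)) :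
    exists f : hom A G, forall s, p s s (lexx s) \oc sapp f s = q s.
  pose f t : hom (A t) (P t) :=
    projT1 (cid (pex t (A t) (fun s h => q s \oc res A h))).
  have fP t s (h : (t <= s)%O) : p t s h \oc f t = q s \oc res A h.
    exact: (projT2 (cid (pex t (A t) (fun s h => q s \oc res A h)))).
  have fn s t (h : (s <= t)%O) : f t \oc res A h = res G h \oc f s.
    apply: pun => u k; have su := le_trans h k.
    rewrite cmpA fP -cmpA (resM A h k su) cmpA (rP _ _ _ _ _ su).
    by rewrite fP.
  by exists (@SheafHom _ S V A G f fn) => s; rewrite /= fP res1 cmpm1.
have ext_un (A : Sh) (f g : hom A G) :
    (forall s, p s s (lexx s) \oc sapp f s = p s s (lexx s) \oc sapp g s) ->
    f = g.
  move=> fg; apply: sheaf_homP => t; apply: pun => s h.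
  rewrite -(rP t s h s (lexx s) h) -!cmpA.
  have n (k : hom A G) : r t s h \oc sapp k t = sapp k s \oc res A h.
    exact: esym (sappE k h).
  by rewrite !n !cmpA fg.
have [m mP] := ext F j.
exists G, m; split.
  move=> A B i im f.
  have ims := (smonoP i).1 im.
  pose g0 s := cid ((jP s).1 _ _ _ (ims s) (p s s (lexx s) \oc sapp f s)).
  have [g gP] := ext B (fun s => projT1 (g0 s)).
  exists g; apply: ext_un => s.
  by rewrite cmpA gP; exact: (projT2 (g0 s)).
apply/smonoP => s; apply/mono0P => Z u mu.
have /mono0P : mono (j s) := (jP s).2; apply.
by rewrite -mP -cmpA mu cmpm0.
Qed.

Lemma limit_ex F : exists L : {L : V & forall s, hom L (F s)},
  is_limit (projT2 L).
Proof.
have [P [p pP]] := fin_product (fun s : S => F s).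
have pun Z (u v : hom Z P) :
    (forall s, p s \oc u = p s \oc v) -> u = v.
  move=> uv; have [w [_ wu]] := pP Z (fun s => p s \oc v).
  by rewrite -(wu v) // -(wu u).
have [Q [q qP]] := fin_product (fun st : S * S => F st.2).
pose D (st : S * S) : hom P (F st.2) :=
  if boolP (st.1 <= st.2)%O is AltTrue h then res F h \oc p st.1 - p st.2
  else 0.
have DE s t (h : (s <= t)%O) : D (s, t) = res F h \oc p s - p t.
  rewrite /D; case: {-}_ / boolP => /= [h'|]; last by rewrite h.
  by rewrite (Prop_irrelevance h' h).
have [f [fD _]] := qP P D.
exists (existT (fun L : V => forall s, hom L (F s)) (ker f)
  (fun s => p s \oc kerm f)); split=> /= [s t h|Z q' q'P].
  apply/eqP; rewrite -subr_eq0 cmpA -cmpBl -DE -fD.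
  by rewrite -cmpA (kermP f).1 cmpm0.
have [u [uq _]] := pP Z q'.
have fu : f \oc u = 0.
  have [w [_ w0]] := qP Z (fun=> 0).
  rewrite -(w0 0) => [|st]; last exact: cmpm0.
  apply/esym/w0 => -[s t]; rewrite cmpA fD.
  have [h|h] := boolP (s <= t)%O.
    by rewrite DE cmpBl -cmpA !uq q'P subrr.
  rewrite /D; case: {-}_ / boolP => /= [h'|_]; last exact: cmp0m.
  by rewrite h' in h.
exists (ker_lift fu); split=> [s|v vq].
  by rewrite -cmpA ker_liftE uq.
apply: (kernel_mono (kermP f)); rewrite ker_liftE.
by apply: pun => s; rewrite uq cmpA vq.
Qed.

Definition sections F : V := projT1 (projT1 (cid (limit_ex F))).
Definition section_at F : forall s, hom (sections F) (F s) :=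
  projT2 (projT1 (cid (limit_ex F))).
Lemma sectionsP F : is_limit (@section_at F).
Proof. exact: projT2 (cid (limit_ex F)). Qed.

Lemma sections_map_ex F G (f : hom F G) :
  exists u : hom (sections F) (sections G),
    forall s, section_at G s \oc u = sapp f s \oc section_at F s.
Proof.
have [|u [uP _]] := (sectionsP G).2 (sections F)
  (fun s => sapp f s \oc section_at F s).
  by move=> s t h; rewrite cmpA -sappE -cmpA (sectionsP F).1.
by exists u.
Qed.

Definition sections_map F G (f : hom F G) : hom (sections F) (sections G) :=
  projT1 (cid (sections_map_ex f)).

Lemma sections_mapE F G (f : hom F G) s :
  section_at G s \oc sections_map f = sapp f s \oc section_at F s.
Proof. exact: (projT2 (cid (sections_map_ex f))). Qed.

Lemma sections_eq F Z (u v : hom Z (sections F)) :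
  (forall s, section_at F s \oc u = section_at F s \oc v) -> u = v.
Proof.
move=> uv; have [|w [_ wP]] := (sectionsP F).2 Z (fun s => section_at F s \oc v).
  by move=> s t h; rewrite cmpA (sectionsP F).1.
by rewrite -(wP v) // -(wP u).
Qed.

Definition global_sections : additive_functor sheaf_abelian V.
Proof.
refine (@AdditiveFunctor sheaf_abelian V sections sections_map _ _ _).
- by move=> F; apply: sections_eq => s; rewrite sections_mapE cmp1m cmpm1.
- move=> F G H g f; apply: sections_eq => s.
  by rewrite cmpA !sections_mapE -!cmpA sections_mapE.
- move=> F G f g; apply: sections_eq => s.
  by rewrite cmpDr !sections_mapE cmpDl.
Defined.

Definition sheaf_cohomology (ei : enough_injectives V) (j : nat) (F : Sh) : V :=
  right_derived global_sections (sheaf_enough_injectives ei) j F.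

End SheafCategory.

Section Restriction.
Context {d : Order.disp_t}.
Variables (S : finPOrderType d) (V : preadditiveCat).

Definition restriction (F : sheaf S V) (A : {set S}) : sheaf (subposet A) V :=
  @Sheaf _ (subposet A) V (fun s => F (val s)) (fun s t h => res F h)
    (fun s h => res1 F h) (fun s t u h k l => resM F h k l).

End Restriction.

(* Main.v *)
(** Let P be the set of elements below s.

    Topology: the singular homology of |P| controls its simplicial homology.
    Label each point of |P| by a vertex whose barycentric coordinate is large.
    Subdividing a singular simplex barycentrically N times and labelling the
    vertices of the pieces gives a chain map from singular chains to sequences
    of vertices.  By uniform continuity its values on a given singular chain are
    sequences of pairwise comparable elements once N is large.  Composed with
    the realization of decreasing sequences as affine singular simplices, and
    followed by a sorting chain map, it is carried by the entries of the given
    sequence, hence homotopic to the identity.  So a simplicial cycle that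
    bounds as a singular chain bounds simplicially, and the augmented chain
    complex of P, being free and exact, has a contraction.

    Algebra: for a sheaf A, the cochains on decreasing sequences x0 >= ... >= xn
    with values in A(x0) form a complex, exact in A.  If it is exact in positive
    degrees on all terms of a resolution of F, dimension shifting identifies the
    cohomology of the global sections of the resolution with that of the cochain
    complex of F.  An injective sheaf on S is a summand of a product of sheaves
    J_u, constant on {t <= u} and zero elsewhere.  The cochains of the
    restriction of J_u to S' = S \ {s} are contracted by prepending u when
    u <> s, and by the contraction of the chains of P when u = s; in degree 0
    this also shows that S and S' give the same sections.  So both cohomologies
    are the cohomology of the cochain complex of F restricted to S'. *)

Require Import Defs.
From mathcomp Require Import all_boot all_order all_algebra.
From mathcomp Require Import all_classical reals.
From HB Require Import structures.
From mathcomp Require Import topology normedtype sequences freeg.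
Require Import Defs.

Set Implicit Arguments.
Unset Strict Implicit.
Unset Printing Implicit Defensive.

Import Order.TTheory GRing.Theory Num.Theory.
Import numFieldNormedType.Exports.
Local Open Scope classical_set_scope.
Local Open Scope ring_scope.

Local Notation "{ 'free' K }" := {freeg K / int}
  (at level 0, K at level 2, format "{ 'free'  K }").
Local Notation "<[ s ]>" := (<< s >> : {free _}) (format "<[ s ]>").

(** * Free abelian groups *)

Section FreeAbelian.
Variable K : choiceType.
Implicit Types (x y : {free K}) (p q : K -> Prop).

Definition supp p y := forall s, s \in dom y -> p s.

(** The basis elements of the support generate a chain under subtraction alone, so identities
    between additive maps need checking only on basis elements. *)
Lemma supp_ind p (P : {free K} -> Prop) :
  P 0 -> (forall x y, P x -> P y -> P (x - y)) ->
  (forall s, p s -> P <[s]>) -> forall y, supp p y -> P y.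
Proof.
move=> P0 PB P1 y py; rewrite -(freeg_sumE y) big_seq.
have PN x : P x -> P (- x) by move=> Px; rewrite -sub0r; exact: PB.
have PD x z : P x -> P z -> P (x + z).
  by move=> Px Pz; rewrite -[z]opprK; apply: PB => //; exact: PN.
have Pn x n : P x -> P (x *+ n).
  by move=> Px; elim: n => [|n IH]; rewrite ?mulr0n // mulrS; exact: PD.
elim/big_rec: _ => [//|s x sy Px]; apply: PD => //.
have -> : << coeff s y *g s >> = <[s]> *~ coeff s y.
  by rewrite freegU_mulz intz.
case: (coeff s y) => n.
  by rewrite -pmulrn; exact/Pn/P1/py.
by rewrite NegzE mulrNz -pmulrn; exact/PN/Pn/P1/py.
Qed.

Lemma free_ind (P : {free K} -> Prop) :
  P 0 -> (forall x y, P x -> P y -> P (x - y)) ->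
  (forall s, P <[s]>) -> forall y, P y.
Proof. by move=> P0 PB P1 y; apply: (@supp_ind (fun=> True)). Qed.

Lemma supp0 p : supp p 0.
Proof. by move=> s; rewrite dom0. Qed.

Lemma suppB p x y : supp p x -> supp p y -> supp p (x - y).
Proof.
by move=> px py s /domB; rewrite mem_cat => /orP[/px|/py].
Qed.

Lemma suppN p x : supp p x -> supp p (- x).
Proof. by move=> px; rewrite -sub0r; apply: suppB => //; exact: supp0. Qed.

Lemma suppD p x y : supp p x -> supp p y -> supp p (x + y).
Proof.
by move=> px py; rewrite -[y]opprK; apply: suppB => //; exact: suppN.
Qed.

Lemma suppU p s : p s -> supp p <[s]>.
Proof. by move=> ps t; rewrite domU1 mem_seq1 => /eqP ->. Qed.

Lemma suppW p q x : (forall s, p s -> q s) -> supp p x -> supp q x.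
Proof. by move=> pq px s /px /pq. Qed.

Variable M : zmodType.

(** [fglift] lands in a module over the coefficients, so the abelian group [M] is viewed through
    [zmodule] as a module over the integers. *)
Definition lin (f : K -> M) (y : {free K}) : M :=
  fglift (f : K -> (zmodule M : lmodType int)) y.

Fact lin_is_additive f : zmod_morphism (lin f).
Proof.
move=> x y.
exact: (lift_is_additive (f : K -> (zmodule M : lmodType int)) x y).
Qed.
HB.instance Definition _ f :=
  GRing.isZmodMorphism.Build {free K} M (lin f) (@lin_is_additive f).

Lemma linU f s : lin f <[s]> = f s.
Proof. by rewrite /lin liftU scale1r. Qed.

Lemma additive_supp_eq p (f g : {additive {free K} -> M}) y :
  (forall s, p s -> f <[s]> = g <[s]>) -> supp p y -> f y = g y.
Proof.
move=> fg; elim/supp_ind => [|x z fx fz|//]; first by rewrite !raddf0.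
by rewrite !raddfB fx fz.
Qed.

Lemma additive_eq (f g : {additive {free K} -> M}) :
  (forall s, f <[s]> = g <[s]>) -> f =1 g.
Proof. by move=> fg y; apply: (@additive_supp_eq (fun=> True)). Qed.

Lemma eq_lin p f g y : (forall s, p s -> f s = g s) -> supp p y ->
  lin f y = lin g y.
Proof. by move=> fg; apply: additive_supp_eq => s /fg fgs; rewrite /= !linU. Qed.

Lemma lin_additive (f : {additive {free K} -> M}) y :
  lin (fun s => f <[s]>) y = f y.
Proof. by apply: additive_eq => s; rewrite /= linU. Qed.

End FreeAbelian.

Lemma supp_lin (K K' : choiceType) (p : K -> Prop) (q : K' -> Prop)
    (f : K -> {free K'}) y :
  (forall s, p s -> supp q (f s)) -> supp p y -> supp q (lin f y).
Proof.
move=> pq; elim/supp_ind => [|x z hx hz|s /pq]; last by rewrite linU.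
  by rewrite raddf0; exact: supp0.
by rewrite raddfB; exact: suppB.
Qed.

Lemma lin_comp (K K' : choiceType) (M : zmodType) (f : K -> {free K'})
    (g : K' -> M) y :
  lin g (lin f y) = lin (fun s => lin g (f s)) y.
Proof.
elim/free_ind: y => [|x y hx hy|s]; first by rewrite !raddf0.
  by rewrite !raddfB /= hx hy.
by rewrite !linU.
Qed.

(** * The augmented complex of finite sequences *)

Section Boundary.
Variable T : choiceType.
Local Notation L := {free (seq T)}.
Implicit Types (s t : seq T) (y : L).

Definition cone (a : T) : L -> L := lin (fun s => <[a :: s]>).
HB.instance Definition _ a := GRing.Additive.on (cone a).

Lemma coneU a s : cone a <[s]> = <[a :: s]>.
Proof. exact: linU. Qed.

(** Recursive form of the alternating sum of deletions (see [bdsE]), chosen so that the cone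
    identity [bd_cone] holds by computation on basis elements. *)
Fixpoint bds s : L := if s is a :: s' then <[s']> - cone a (bds s') else 0.

(* The augmented boundary: the empty sequence is a chain of degree -1. *)
Definition bd : L -> L := lin bds.
HB.instance Definition _ := GRing.Additive.on bd.

Lemma bdU s : bd <[s]> = bds s.
Proof. exact: linU. Qed.

(** Cones contract the augmented complex: a cycle is the boundary of its cone over any apex. *)
Lemma bd_cone a y : bd (cone a y) = y - cone a (bd y).
Proof.
elim/free_ind: y => [|x y hx hy|s]; first by rewrite !raddf0 addr0.
  rewrite (raddfB (cone a)) !(raddfB bd) (raddfB (cone a)) /= hx hy.
  by rewrite !opprD !opprK addrACA.
by rewrite coneU !bdU.
Qed.

Lemma bd_bds s : bd (bds s) = 0.
Proof.
elim: s => [|a s IH] /=; first by rewrite raddf0.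
by rewrite raddfB /= bd_cone IH raddf0 subr0 bdU subrr.
Qed.

Lemma bd_bd y : bd (bd y) = 0.
Proof.
elim/free_ind: y => [|x y hx hy|s]; first by rewrite !raddf0.
  by rewrite !raddfB /= hx hy subr0.
by rewrite bdU bd_bds.
Qed.

Lemma supp_cone (p q : seq T -> Prop) a y :
  (forall s, p s -> q (a :: s)) -> supp p y -> supp q (cone a y).
Proof. by move=> pq; apply: supp_lin => s /pq qs; exact: suppU. Qed.

Lemma supp_bds s : supp (fun t => subseq t s /\ (size t).+1 = size s) (bds s).
Proof.
elim: s => [|a s IH] /=; first exact: supp0.
apply: suppB; first by apply: suppU; split=> //; exact: subseq_cons.
apply: (supp_cone _ IH) => t /= [ts <-]; split=> //=.
by rewrite eqxx.
Qed.

Lemma bdsE s : bds s =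
  \sum_(i < size s) <[take i s ++ drop i.+1 s]> *~ ((-1) ^+ i).
Proof.
elim: s => [|a s IH] /=; first by rewrite big_ord0.
rewrite big_ord_recl /= mulr1z drop0; congr (_ + _).
rewrite IH raddf_sum -sumrN; apply: eq_bigr => i _.
by rewrite raddfMz /= coneU -mulrNz exprS mulN1r.
Qed.

End Boundary.

Arguments bd {T} _.

Section MapChain.
Variables (T U : choiceType) (f : T -> U).

Definition mapc : {free (seq T)} -> {free (seq U)} :=
  lin (fun s => <[map f s]>).
HB.instance Definition _ := GRing.Additive.on mapc.

Lemma mapcU s : mapc <[s]> = <[map f s]>.
Proof. exact: linU. Qed.

Lemma mapc_cone a y : mapc (cone a y) = cone (f a) (mapc y).
Proof.
elim/free_ind: y => [|x y hx hy|s]; first by rewrite !raddf0.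
  by rewrite !raddfB /= hx hy.
by rewrite mapcU !coneU mapcU.
Qed.

Lemma bd_mapc y : bd (mapc y) = mapc (bd y).
Proof.
elim/free_ind: y => [|x y hx hy|s]; first by rewrite !raddf0.
  by rewrite !raddfB /= hx hy.
rewrite mapcU !bdU; elim: s => [|a s IH] /=; first by rewrite raddf0.
by rewrite raddfB /= mapcU IH mapc_cone.
Qed.

End MapChain.

Lemma mapc_comp (T U W : choiceType) (f : T -> U) (g : U -> W) y :
  mapc g (mapc f y) = mapc (g \o f) y.
Proof.
elim/free_ind: y => [|x y hx hy|s]; first by rewrite !raddf0.
  by rewrite !raddfB /= hx hy.
by rewrite !mapcU map_comp.
Qed.

Lemma supp_mapc (T U : choiceType) (g : T -> U) (p : seq T -> Prop)
    (q : seq U -> Prop) y :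
  (forall t, p t -> q (map g t)) -> supp p y -> supp q (mapc g y).
Proof. by move=> pq; apply: supp_lin => t /pq qt; exact: suppU. Qed.

(** * Chain maps by recursive coning, shared by subdivision and sorting *)

Section ConeMap.
Variables (T U : choiceType) (b : T -> seq T -> U).

(* conem n is only meaningful on chains of sequences of size n. *)
Fixpoint conems (n : nat) (s : seq T) : {free (seq U)} :=
  match n, s with
  | 0, _ => <[[::]]>
  | n'.+1, x :: s' => cone (b x s') (lin (conems n') (bds s))
  | _, [::] => 0
  end.

Definition conem n : {free (seq T)} -> {free (seq U)} := lin (conems n).
HB.instance Definition _ n := GRing.Additive.on (conem n).

Lemma conemU n s : conem n <[s]> = conems n s.
Proof. exact: linU. Qed.

Lemma conem0 s : conem 0 <[s]> = <[[::]]>.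
Proof. by rewrite /conem linU. Qed.

Lemma conemS n x s : conem n.+1 <[x :: s]> = cone (b x s) (conem n (bds (x :: s))).
Proof. by rewrite /conem linU. Qed.

(** Whatever the apexes [b], the cone identity leaves the image of [bds s] minus a cone over its
    boundary; by induction that boundary is the image of [bd (bds s) = 0]. *)
Lemma bd_conems n s : size s = n.+1 ->
  bd (conem n.+1 <[s]>) = conem n (bds s).
Proof.
elim: n s => [|n IH] [|x s] // [ss]; rewrite conemS bd_cone.
  by case: s ss => //= _; rewrite !raddf0 addr0 conem0 bdU /= raddf0 subr0.
set y := bds _; have: supp (fun t => size t = n.+1) y.
  by apply: (suppW _ (@supp_bds _ _)) => t [_ [->]].
have by0 : bd y = 0 by exact: bd_bds.
suff H z : supp (fun t => size t = n.+1) z ->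
    bd (conem n.+1 z) = conem n (bd z).
  by move=> /H ->; rewrite by0 !raddf0 addr0.
elim/supp_ind => [|u v hu hv|t /IH ->]; first by rewrite !raddf0.
  by rewrite !raddfB /= hu hv.
by rewrite bdU.
Qed.

Lemma bd_conem n y : supp (fun t => size t = n.+1) y ->
  bd (conem n.+1 y) = conem n (bd y).
Proof.
elim/supp_ind => [|u v hu hv|t /bd_conems ->]; first by rewrite !raddf0.
  by rewrite !raddfB /= hu hv.
by rewrite bdU.
Qed.

End ConeMap.
Arguments bds : simpl never.

Lemma subrACA3 (M : zmodType) (a b c a' b' c' : M) :
  (a - b - c) - (a' - b' - c') = (a - a') - (b - b') - (c - c').
Proof.
by rewrite !opprD !opprK addrACA; congr (_ + _); rewrite addrACA.
Qed.

(** * Chains of a poset *)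

Section Decreasing.
Context {d : Order.disp_t} {T : finPOrderType d}.
Local Notation L := {free (seq T)}.
Implicit Types (s t : seq T) (y : L).

(** The index counts entries, so the degree is one less and the empty sequence carries the
    augmentation. Repetitions are allowed: degenerate simplices are kept, so that coning with the
    head of a sequence preserves decreasing sequences. *)
Definition dec (n : nat) s : Prop :=
  sorted (fun a b : T => (b <= a)%O) s /\ size s = n.

Let ge_trans : transitive (fun a b : T => (b <= a)%O).
Proof. by move=> a b c ab ca; exact: le_trans ca ab. Qed.

Lemma dec_cons a n s : dec n s -> (forall b, b \in s -> (b <= a)%O) ->
  dec n.+1 (a :: s).
Proof.
move=> [ss <-] sa; split=> //=; rewrite path_sortedE // ss andbT.
by apply/allP.
Qed.

Lemma dec_head a n s b : dec n (a :: s) -> b \in a :: s -> (b <= a)%O.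
Proof.
move=> [/= + _]; rewrite path_sortedE // => /andP[/allP sa _].
by rewrite inE => /predU1P[->//|/sa].
Qed.

Lemma dec_subseq n m s t : dec n s -> subseq t s -> size t = m -> dec m t.
Proof.
by move=> [ss _] ts tm; split=> //; exact: subseq_sorted ts ss.
Qed.

Lemma supp_bds_dec n s : dec n.+1 s ->
  supp (fun t => dec n t /\ {subset t <= s}) (bds s).
Proof.
move=> ds; apply: (suppW _ (@supp_bds _ s)) => t [ts]; rewrite ds.2 => -[tn].
by split; [exact: dec_subseq ds ts tn | exact: mem_subseq].
Qed.

Lemma lin1_bd y : supp (dec 1) y -> lin (fun=> 1 : int) (bd y) = lin (fun=> 1) y.
Proof.
elim/supp_ind => [|u v hu hv|s [_ ]]; first by rewrite !raddf0.
  by rewrite !raddfB /= hu hv.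
case: s => [|a [|//]] // _.
by rewrite bdU -bdU bdU /bds raddf0 subr0 !linU.
Qed.

(* A chain map carried by the decreasing sequences with entries among those of
   the given sequence is homotopic to the identity: cone off with the head. *)
Section Homotopy.
Variable Psi : nat -> {additive L -> L}.
Hypothesis Psi_bd : forall n s, dec n.+1 s ->
  bd (Psi n.+1 <[s]>) = Psi n (bds s).
Hypothesis Psi0 : Psi 0 <[[::]]> = <[[::]]>.
Hypothesis Psi_supp : forall n s, dec n s ->
  supp (fun t => dec n t /\ {subset t <= s}) (Psi n <[s]>).

Fixpoint htpys (n : nat) s : L :=
  match n, s with
  | n'.+1, a :: s' =>
    cone a (<[s]> - Psi n <[s]> - lin (htpys n') (bds s))
  | _, _ => 0
  end.

Lemma supp_htpys n s : dec n s ->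
  supp (fun t => dec n.+1 t /\ {subset t <= s}) (htpys n s).
Proof.
elim: n s => [|n IH] [|a s] ds; try exact: supp0.
rewrite /htpys -/htpys.
apply: (@supp_cone _ (fun t => dec n.+1 t /\ {subset t <= a :: s})).
  move=> t [dt ts]; split.
    by apply: dec_cons => // b /ts; exact: dec_head ds.
  by move=> b; rewrite inE => /predU1P[->|/ts//]; exact: mem_head.
apply: suppB; last first.
  apply: supp_lin (supp_bds_dec ds) => t [dt ts].
  apply: (suppW _ (@IH t dt)) => u [du ut]; split=> // b /ut; exact: ts.
apply: suppB; [by apply: suppU; split | exact: Psi_supp].
Qed.

(** The chain that is coned is a cycle, by induction and because [Psi] commutes with the boundary;
    hence the error term of [bd_cone] vanishes. In degree -1 both sides vanish since [Psi] fixes the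
    empty sequence. *)
Lemma bd_htpys n s : dec n s ->
  bd (htpys n s) = <[s]> - Psi n <[s]> - lin (htpys n.-1) (bds s).
Proof.
elim: n s => [|n IH] [|a s] ds; try by case: ds.
  by rewrite Psi0 subrr sub0r !raddf0.
rewrite /htpys -/htpys bd_cone; set y := (X in cone _ (bd X)).
rewrite -[RHS]subr0; congr (_ - _).
suff -> : bd y = 0 by rewrite raddf0.
have H z : supp (dec n) z ->
    bd (lin (htpys n) z) = z - Psi n z - lin (htpys n.-1) (bd z).
  elim/supp_ind => [|u v hu hv|t /IH]; last by rewrite linU bdU.
    by rewrite !raddf0 !addr0.
  rewrite (raddfB (lin (htpys n))) !(raddfB bd) (raddfB (Psi n)) (raddfB (lin _)).
  by rewrite /= hu hv subrACA3.
rewrite /y 2!raddfB /= bdU H; last first.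
  by apply: (suppW _ (supp_bds_dec ds)) => t [].
by rewrite Psi_bd // bd_bds raddf0 subr0 subrr.
Qed.

Lemma htpy_bd n z : supp (dec n) z -> bd z = 0 ->
  exists2 w, supp (dec n.+1) w & bd w = z - Psi n z.
Proof.
move=> sz bz; exists (lin (htpys n) z).
  by apply: supp_lin sz => s /supp_htpys; apply: suppW => t [].
suff -> : bd (lin (htpys n) z) = z - Psi n z - lin (htpys n.-1) (bd z).
  by rewrite bz raddf0 subr0.
elim/supp_ind: sz => [|u v hu hv|t /bd_htpys]; last by rewrite linU bdU.
  by rewrite !raddf0 !addr0.
rewrite (raddfB (lin (htpys n))) !(raddfB bd) (raddfB (Psi n)) (raddfB (lin _)).
by rewrite /= hu hv subrACA3.
Qed.

End Homotopy.

(** The default [a] is reached only if the entries have no maximum, which [maxsP] excludes for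
    chains. *)
Definition maxs (a : T) s : T :=
  odflt a [pick b | (b \in a :: s) && all (fun c => (c <= b)%O) (a :: s)].

Definition pchain s : Prop := {in s &, forall a b, (a >=< b)%O}.

Lemma maxsP a s : pchain (a :: s) ->
  maxs a s \in a :: s /\ forall c, c \in a :: s -> (c <= maxs a s)%O.
Proof.
move=> cs; rewrite /maxs; case: pickP => [b /andP[bs /allP sb]|] //.
suff [b bs sb] : exists2 b, b \in a :: s &
    forall c, c \in a :: s -> (c <= b)%O.
  move/allP: sb => sb.
  by move=> /(_ b) => /idP[]; apply/andP; split.
elim: s a cs => [|e s IH] a cs.
  by exists a; rewrite ?mem_head // => c; rewrite mem_seq1 => /eqP ->.
have [|b bs sb] := IH e.
  by move=> u v us vs; apply: cs; rewrite inE ?us ?vs orbT.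
have ba : b \in [:: a, e & s] by rewrite inE bs orbT.
have /orP[ab|lba] := cs a b (mem_head _ _) ba.
  by exists b => // c; rewrite inE => /predU1P[->|/sb].
exists a; rewrite ?mem_head // => c; rewrite inE => /predU1P[->//|/sb cb].
exact: le_trans cb lba.
Qed.

(** Sorting as a chain map: the sorted faces are coned from the largest entry, and the recursion
    takes care of signs and repetitions. *)
Definition sortc n : L -> L := conem maxs n.
HB.instance Definition _ n := GRing.Additive.on (sortc n).

Lemma supp_sortc n s : pchain s -> size s = n ->
  supp (fun t => dec n t /\ {subset t <= s}) (sortc n <[s]>).
Proof.
elim: n s => [|n IH] [|a s] // cs.
  by move=> _; rewrite /sortc conem0; exact: suppU.
case=> sn; have [ms sm] := maxsP cs.
rewrite /sortc conemS.
apply: (@supp_cone _ (fun t => dec n t /\ {subset t <= a :: s})).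
  move=> t [dt ts]; split; first by apply: dec_cons => // b /ts /sm.
  by move=> b; rewrite inE => /predU1P[->//|/ts].
apply: supp_lin (@supp_bds _ _) => t [ts tn].
rewrite -conemU; apply: (suppW _ (@IH t _ _)); last by case: tn; rewrite sn.
- by move=> u [du ut]; split=> // b /ut; exact: mem_subseq ts _.
- by move=> u v /(mem_subseq ts) us /(mem_subseq ts) vs; exact: cs.
Qed.

End Decreasing.

(** * Barycentric subdivision *)

Section ConeMapSupport.
Variables (T : choiceType) (b : T -> seq T -> T).
Local Notation L := {free (seq T)}.
Implicit Types (s t : seq T).

Fact iter_is_additive (M : zmodType) (f : {additive M -> M}) N :
  zmod_morphism (iter N f).
Proof. by elim: N => [|N IH] x y //=; rewrite IH raddfB. Qed.
HB.instance Definition _ (M : zmodType) (f : {additive M -> M}) N :=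
  GRing.isZmodMorphism.Build M M (iter N f) (@iter_is_additive M f N).

Definition sdiv N m : L -> L := iter N (conem b m).
HB.instance Definition _ N m := GRing.Additive.on (sdiv N m).

Lemma supp_conem_size m s : size s = m ->
  supp (fun t => size t = m) (conem b m <[s]>).
Proof.
elim: m s => [|m IH] [|a s] //; first by move=> _; rewrite conem0; exact: suppU.
case=> sm; rewrite conemS.
apply: (@supp_cone _ (fun t => size t = m)) => [t /= -> //|].
apply: supp_lin (@supp_bds _ _) => t [_ [tm]].
by rewrite -conemU; apply: IH; rewrite tm.
Qed.

Lemma supp_sdiv_size N m y : supp (fun t => size t = m) y ->
  supp (fun t => size t = m) (sdiv N m y).
Proof.
move=> sy; elim: N => [//|N IH]; apply: supp_lin IH => s sm.
by rewrite -conemU; exact: supp_conem_size.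
Qed.

Lemma bd_sdiv N m y : supp (fun t => size t = m.+1) y ->
  bd (sdiv N m.+1 y) = sdiv N m (bd y).
Proof.
move=> sy; elim: N => [//|N IH].
by rewrite /sdiv !iterS bd_conem ?IH //; exact: supp_sdiv_size.
Qed.

(** * The mesh estimate, one coordinate at a time *)

Section Mesh.
Variables (R : realType) (f : T -> R).
Hypothesis fb : forall a s,
  f (b a s) = (\sum_(x <- a :: s) f x) / (size s).+1%:R.

Lemma sum_le_size (r : seq T) (g : T -> R) c :
  (forall x, x \in r -> g x <= c) -> \sum_(x <- r) g x <= (size r)%:R * c.
Proof.
elim: r => [|a r IH] rc; first by rewrite big_nil mul0r.
rewrite big_cons /= -natr1 mulrDl mul1r addrC lerD //.
  by apply: IH => x xr; apply: rc; rewrite inE xr orbT.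
by apply: rc; exact: mem_head.
Qed.

Lemma conem_conv m s lo hi : size s = m ->
  (forall x, x \in s -> lo <= f x <= hi) ->
  supp (fun t => forall x, x \in t -> lo <= f x <= hi) (conem b m <[s]>).
Proof.
elim: m s => [|m IH] [|a s] // sm sb.
  by rewrite conem0; apply: suppU.
case: sm => sm; rewrite conemS.
apply: (@supp_cone _ (fun t => forall x, x \in t -> lo <= f x <= hi)).
  move=> t tb x; rewrite inE => /predU1P[->|/tb//].
  rewrite fb ler_pdivlMr ?ltr0n // ler_pdivrMr ?ltr0n // !(mulrC _ _%:R).
  apply/andP; split; last first.
    by apply: (@sum_le_size (a :: s)) => y /sb /andP[].
  rewrite -lerN2 -mulrN -sumrN.
  by apply: (@sum_le_size (a :: s)) => y /sb /andP[]; rewrite lerN2.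
apply: supp_lin (@supp_bds _ _) => t [ts tn].
rewrite -conemU; apply: IH; first by case: tn; rewrite sm.
by move=> x /(mem_subseq ts); exact: sb.
Qed.

Definition osc D s : Prop := {in s &, forall x y, `|f x - f y| <= D}.

(** The difference is the average of the [f y - f x] over all vertices [y]. The term of [x] itself
    is 0 and the others are at most [D], which gives the factor n/(n+1) for n+1 vertices, at most
    M/(M+1). *)
Lemma bary_dist M D a s x : (size s <= M)%N -> osc D (a :: s) ->
  x \in a :: s -> `|f (b a s) - f x| <= (1 - M.+1%:R^-1) * D.
Proof.
move=> sM so xs; have D0 : 0 <= D.
  exact: le_trans (normr_ge0 _) (so _ _ xs xs).
apply: (@le_trans _ _ ((1 - (size s).+1%:R^-1) * D)); last first.
  by rewrite ler_wpM2r // lerB // lef_pV2 ?posrE ?ltr0n // ler_nat ltnS.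
have -> : f (b a s) - f x = (\sum_(y <- a :: s) (f y - f x)) / (size s).+1%:R.
  rewrite fb sumrB big_const_seq count_predT iter_addr_0 mulrBl.
  by rewrite -(mulr_natr (f x)) mulfK // pnatr_eq0.
rewrite normrM [X in _ * X]ger0_norm ?invr_ge0 //.
have -> : (1 - (size s).+1%:R^-1) * D = (size s)%:R * D / (size s).+1%:R.
  rewrite -{1}[1](@divff _ (size s).+1%:R) ?pnatr_eq0 //.
  by rewrite -[X in _ - X]mul1r -mulrBl -natr1 addrK mulrAC.
rewrite ler_wpM2r ?invr_ge0 //.
apply: le_trans (ler_norm_sum _ _ _) _.
rewrite (perm_big _ (perm_to_rem xs)).
have -> : size s = size (rem x (a :: s)) by rewrite size_rem.
have : {subset rem x (a :: s) <= a :: s} by move=> y; exact: mem_rem.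
move: (rem _ _) => r rs; rewrite big_cons /= subrr normr0 add0r.
by apply: sum_le_size => y /rs ys; exact: so.
Qed.

(** Two vertices of a piece either both come from the subdivision of a face, where induction
    applies, or one is the barycentre. Its distance to the vertices bounds its distance to all their
    averages, by [conem_conv]. Fixing [M] keeps one factor for all dimensions. *)
Lemma conem_osc M m D s : size s = m -> (m <= M.+1)%N -> osc D s ->
  supp (osc ((1 - M.+1%:R^-1) * D)) (conem b m <[s]>).
Proof.
elim: m s => [|m IH] [|a s] // sm mM so; first by rewrite conem0; apply: suppU.
case: sm => sm; rewrite conemS; set q := (1 - _) * D.
pose bb x := f (b a s) - q <= f x <= f (b a s) + q.
apply: (@supp_cone _ (fun t => osc q t /\ forall x, x \in t -> bb x)).
  move=> t [to tb] x y; have tb' z : z \in t -> `|f (b a s) - f z| <= q.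
    by move=> /tb; rewrite distrC ler_distl.
  have q0 : 0 <= q.
    by apply: le_trans (normr_ge0 _) (bary_dist _ so (mem_head _ _)); rewrite sm.
  rewrite !inE => /predU1P[->|xt] /predU1P[->|yt].
  - by rewrite subrr normr0.
  - exact: tb'.
  - by rewrite distrC; exact: tb'.
  - exact: to.
apply: supp_lin (@supp_bds _ _) => t [ts tn]; rewrite -conemU.
have tm : size t = m by case: tn; rewrite sm.
have {}so' : osc D t by move=> x y /(mem_subseq ts) xs /(mem_subseq ts); exact: so.
move=> u ut; split.
  by move: (ut); apply: IH => //; exact: ltnW.
apply: (conem_conv tm) ut => x /(mem_subseq ts) xs.
rewrite -ler_distl distrC; apply: bary_dist => //; by rewrite sm.
Qed.

Lemma sdiv_osc M m N D y : (m <= M.+1)%N ->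
  supp (fun t => size t = m /\ osc D t) y ->
  supp (osc ((1 - M.+1%:R^-1) ^+ N * D)) (sdiv N m y).
Proof.
move=> mM sy.
suff : supp (fun t => size t = m /\ osc ((1 - M.+1%:R^-1) ^+ N * D) t)
    (sdiv N m y) by apply: suppW => t [].
elim: N => [|N IH]; first by rewrite mul1r.
apply: supp_lin IH => s [sm so]; rewrite -conemU => t ts; split.
  exact: (supp_conem_size sm ts).
by rewrite exprS -mulrA; exact: (conem_osc sm mM so ts).
Qed.

End Mesh.
End ConeMapSupport.

Lemma mapc_conem (T U : choiceType) (g : T -> U) b b' m y :
  (forall a s, g (b a s) = b' (g a) (map g s)) ->
  mapc g (conem b m y) = conem b' m (mapc g y).
Proof.
move=> gb; elim: m y => [|m IH] y.
  elim/free_ind: y => [|x y hx hy|s]; first by rewrite !raddf0.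
    by rewrite !raddfB /= hx hy.
  by rewrite mapcU !conem0 mapcU.
elim/free_ind: y => [|x y hx hy|[|a s]]; first by rewrite !raddf0.
    by rewrite !raddfB /= hx hy.
  by rewrite mapcU /conem !linU /= raddf0.
by rewrite mapcU /= !conemS mapc_cone gb IH -!bdU -bd_mapc mapcU.
Qed.

Lemma mapc_sdiv (T U : choiceType) (g : T -> U) b b' N m y :
  (forall a s, g (b a s) = b' (g a) (map g s)) ->
  mapc g (sdiv b N m y) = sdiv b' N m (mapc g y).
Proof.
move=> gb; elim: N => [//|N IH]; rewrite /sdiv in IH *.
by rewrite !iterS -IH; exact: mapc_conem.
Qed.

(** * Topological simplices *)

Section SimplexGeometry.
Variable R : realType.

Lemma sum_continuous (X : topologicalType) (J : Type) (r : seq J)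
    (f : J -> X -> R) :
  (forall j, continuous (f j)) -> continuous (fun x => \sum_(j <- r) f j x).
Proof.
move=> cf; elim: r => [|a r IH].
  suff -> : (fun x => \sum_(j <- [::]) f j x) = cst 0.
    by move=> x; exact: cst_continuous.
  by apply/funext => x; rewrite big_nil.
suff -> : (fun x => \sum_(j <- a :: r) f j x) =
    (fun x => f a x + \sum_(j <- r) f j x).
  by move=> x; apply: cvgD; [exact: cf|exact: IH].
by apply/funext => x; rewrite big_cons.
Qed.

Section UniformContinuity.
Variable I : finType.

(** As [I] is finite, the cubes of a common radius generate a filter [F]; its convergence to [z] is
    checked coordinatewise. *)
Lemma ptws_box (z : {ptws I -> R}) (U : set {ptws I -> R}) : nbhs z U ->
  exists2 r : R, 0 < r &
    forall w : {ptws I -> R}, (forall i, `|z i - w i| < r) -> U w.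
Proof.
pose F := filter_from [set r : R | 0 < r]
  (fun r => [set w : {ptws I -> R} | forall i, `|z i - w i| < r]).
have FF : Filter F.
  apply: filter_from_filter; first by exists 1 => /=.
  move=> r s /= r0 s0; exists (Num.min r s); first by rewrite /= lt_min r0.
  by move=> w /= zw; split=> i; have := zw i; rewrite lt_min => /andP[].
suff : F --> z by move=> /[apply].
apply/cvg_sup => i W [/= _ [[O oO <-] Oz] sOW].
have /nbhs_ballP[r /= r0 rO] : nbhs (z i) O by exact: open_nbhs_nbhs.
by exists r => //= w zw; apply: sOW; apply: rO; exact: zw.
Qed.

Lemma ptws_box_nbhs (z : {ptws I -> R}) (r : R) : 0 < r ->
  \forall w \near z, forall i, `|z i - w i| < r.
Proof.
move=> r0; apply: (@filter_forall _ I
  (fun i (w : {ptws I -> R}) => `|z i - w i| < r) (nbhs z)) => i.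
have cp := @proj_continuous _ (fun _ : I => R : topologicalType) i z.
exact: (cp _ (nbhsx_ballx (z i) r r0)).
Qed.

(** The simplex is closed in a cube, which is compact by Tychonoff's theorem. *)
Lemma simplex_compact : compact (@simplex_set R I).
Proof.
apply: (@subclosed_compact _ _
    ([set f | forall i, `[0, 1]%classic (f i)] : set {ptws I -> R})); last 2 first.
- exact: (@tychonoff I (fun=> R : topologicalType) (fun=> `[0, 1]%classic)
    (fun=> @segment_compact R 0 1)).
- move=> x [x0 x1] i /=; rewrite in_itv /= x0 -x1 (bigD1 i) //= lerDl.
  by apply: sumr_ge0 => j _.
have cproj i : continuous (fun x : {ptws I -> R} => x i).
  by move=> z; exact: (@proj_continuous _ (fun _ : I => R : topologicalType) i z).
have -> : @simplex_set R I =
  (\bigcap_(i in [set: I])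
    ((fun x : {ptws I -> R} => x i) @^-1` [set r | 0 <= r]))
  `&` ((fun x : {ptws I -> R} => \sum_v x v) @^-1` [set 1]).
  apply/seteqP; split=> x [x0 x1]; split=> //; first by move=> i _; exact: x0.
  by move=> i; exact: x0.
apply: closedI.
  apply: closed_bigI => i _.
  by apply: closed_comp => [z _|]; [exact: cproj|exact: closed_ge].
apply: closed_comp; last exact: closed_eq.
by move=> z _; exact: sum_continuous.
Qed.

(** The Heine-Cantor theorem for the coordinatewise distance, by the near-covering form of
    compactness. *)
Lemma simplex_unif_cont (f : set_type (@simplex_set R I) -> R) (D : R) : 0 < D ->
  continuous f -> exists2 r : R, 0 < r & forall x y : set_type (@simplex_set R I),
    (forall i, `|val x i - val y i| < r) -> `|f x - f y| < D.
Proof.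
move=> D0 cf.
(* Neighbourhoods are taken in the ambient power of [R]; at points [z] outside the simplex [P r z]
   is vacuous. *)
pose P (r : R) (z : {ptws I -> R}) := forall x y : set_type (@simplex_set R I),
  val x = z -> (forall i, `|val x i - val y i| < r) -> `|f x - f y| < D.
have D20 : 0 < D / 2 by rewrite divr_gt0.
have /compact_near_coveringP/(_ _ (0 : R)^'+ P) := simplex_compact.
case.
  move=> z Kz; pose x0 : set_type (@simplex_set R I) := exist _ z (mem_set Kz).
  have : nbhs x0 [set y | `|f x0 - f y| < D / 2].
    exact: (cf x0 _ (nbhsx_ballx (f x0) _ D20)).
  case=> /= _ [[O oO <-] Oz sO].
  have /ptws_box[r r0 rO] : nbhs z O by exact: open_nbhs_nbhs.
  have fr (y : set_type (@simplex_set R I)) :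
      (forall i, `|z i - val y i| < r) -> `|f x0 - f y| < D / 2.
    by move=> zy; apply: sO; apply: rO.
  have r20 : 0 < r / 2 by rewrite divr_gt0.
  near=> w e.
  have nw : forall i, `|z i - w i| < r / 2.
    near: w; exact: ptws_box_nbhs.
  have er : e < r / 2 by near: e; exact: nbhs_right_lt.
  move=> x y xw xy.
  have zw : forall i, `|z i - val x i| < r / 2.
    by rewrite xw.
  rewrite (splitr D) -(subrK (f x0) (f x)) -addrA.
  apply: le_lt_trans (ler_normD _ _) _; apply: ltrD.
    rewrite distrC; apply: fr => i; apply: lt_trans (zw i) _.
    by rewrite ltr_pdivrMr // ltr_pMr // ltr1n.
  apply: fr => i; rewrite (splitr r) -(subrK (val x i) (z i)) -addrA.
  apply: le_lt_trans (ler_normD _ _) _; apply: ltrD => //.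
  exact: lt_trans (xy i) er.
move=> e /= e0 eP; exists (e / 2); first by rewrite divr_gt0.
move=> x y xy; apply: (eP (e / 2) _ _ (val x) _ x y) => //=.
- by rewrite sub0r normrN gtr0_norm ?divr_gt0 // ltr_pdivrMr // ltr_pMr // ltr1n.
- by rewrite divr_gt0.
- by case: x xy => x /= /set_mem.
Unshelve. all: by end_near.
Qed.

End UniformContinuity.

Definition vert_fun n (i : 'I_n.+1) : 'I_n.+1 -> R := fun j => (j == i)%:R.

Lemma vert_simplex n (i : 'I_n.+1) : vert_fun i \in @simplex_set R 'I_n.+1.
Proof.
apply/mem_set; split=> [j|]; first exact: ler0n.
rewrite (bigD1 i) //= /vert_fun eqxx big1 ?addr0 //.
by move=> j /negPf ->.
Qed.

Definition vert n (i : 'I_n.+1) : std_simplex R n :=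
  exist _ (vert_fun i) (vert_simplex i).

Definition bary_fun n (a : std_simplex R n) (s : seq (std_simplex R n)) :
    'I_n.+1 -> R :=
  fun j => (\sum_(x <- a :: s) val x j) / (size s).+1%:R.

Lemma bary_simplex n (a : std_simplex R n) s :
  bary_fun a s \in @simplex_set R 'I_n.+1.
Proof.
apply/mem_set; split=> [j|].
  rewrite divr_ge0 //; apply: sumr_ge0 => x _.
  by case: x => x /= /set_mem [].
rewrite -mulr_suml exchange_big /= (eq_bigr (fun=> 1)).
  rewrite big_const_seq count_predT iter_addr_0 divff // pnatr_eq0 //.
by move=> x _; case: x => x /= /set_mem [].
Qed.

Definition bary n (a : std_simplex R n) s : std_simplex R n :=
  exist _ (bary_fun a s) (bary_simplex a s).

Lemma std_simplex_eq n (x y : std_simplex R n) : val x =1 val y -> x = y.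
Proof. by move=> xy; apply: val_inj; apply/funext. Qed.

(** Cofaces are affine and so commute with averages; subdivision is therefore natural with respect
    to faces. *)
Lemma coface_bary n (i : 'I_n.+2) a s :
  coface i (bary a s) = bary (coface i a) (map (@coface R n i) s).
Proof.
apply: std_simplex_eq => j; rewrite /= /bary_fun size_map big_cons big_map.
rewrite /coface_fun /= /coface_fun; case: unlift => [k|].
  by rewrite big_cons.
by rewrite big1_eq addr0 mul0r.
Qed.

Lemma coface_vert n (i : 'I_n.+2) (j : 'I_n.+1) :
  coface i (vert j) = vert (fintype.lift i j).
Proof.
apply: std_simplex_eq => k /=; rewrite /coface_fun /vert_fun.
case: unliftP => [l ->|->]; first by rewrite (inj_eq lift_inj).
by rewrite (negPf (neq_lift _ _)).
Qed.

End SimplexGeometry.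

(** * Labelled subdivisions of singular simplices *)

Section Comparison.
Variables (R : realType) (d : Order.disp_t) (P : finPOrderType d).
Local Notation X := (poset_realization R P).
Local Notation Delta n := (std_simplex R n).

Lemma realization_continuous (Y : topologicalType) (I : eqType)
    (A : set {ptws I -> R}) (f : Y -> set_type A) :
  (forall i, continuous (fun y => val (f y) i)) -> continuous f.
Proof.
move=> cf; apply: continuous_comp_initial => y; apply/cvg_sup.
move=> i U [/= _ [[O oO <-] Oy] sOU].
apply: filterS sOU _; apply: (cf i y); exact: open_nbhs_nbhs.
Qed.

Lemma realization_coord_continuous (Y : topologicalType) (I : eqType)
    (A : set {ptws I -> R}) (f : Y -> set_type A) i :
  continuous f -> continuous (fun y => val (f y) i).
Proof.
move=> cf y.
have cv : continuous (set_val : set_type A -> {ptws I -> R}).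
  exact: initial_continuous.
have cp := @proj_continuous _ (fun _ : I => R : topologicalType) i.
have cs := @continuous_comp _ _ {ptws I -> R} f _ y (cf y) (cv (f y)).
exact: (@continuous_comp _ {ptws I -> R} _ _ _ y cs (cp _)).
Qed.

(* The barycentric coordinates sum to 1 > #|P| * label_bound. *)
Definition label_bound : R := #|P|.+1%:R^-1.

Lemma label_bound_gt0 : 0 < label_bound.
Proof. by rewrite invr_gt0 ltr0n. Qed.

Lemma realization_comparable (y : X) u v : val y u != 0 -> val y v != 0 ->
  (u >=< v)%O.
Proof.
case: y => y /= /set_mem [_]; rewrite inE => /andP[_ /forall_inP cy] yu yv.
have mem w : y w != 0 -> w \in [set v | y v != 0]%SET by rewrite inE.
exact: (forall_inP (cy u (mem u yu)) v (mem v yv)).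
Qed.

Lemma label_ex (y : X) : exists u, label_bound <= val y u.
Proof.
apply: contrapT => /forallNP yn.
have y1 : \sum_v val y v = 1 by case: (y) => z /= /set_mem [[]].
have : \sum_v val y v <= \sum_(v : P) label_bound.
  by apply: ler_sum => v _; rewrite ltW // ltNge; exact/negP/yn.
rewrite y1 sumr_const -mulr_natl -[X in X <= _](@divff _ #|P|.+1%:R) ?pnatr_eq0 //.
by rewrite ler_pM2r ?label_bound_gt0 // ler_nat ltnn.
Qed.

Definition label (y : X) : P := projT1 (cid (label_ex y)).

Lemma labelP y : label_bound <= val y (label y).
Proof. exact: projT2 (cid (label_ex y)). Qed.

Lemma label_neq0 y : val y (label y) != 0.
Proof. by rewrite gt_eqF // (lt_le_trans label_bound_gt0) // labelP. Qed.

Definition verts n : seq (Delta n) := [seq vert R i | i <- enum 'I_n.+1].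

Lemma size_verts n : size (verts n) = n.+1.
Proof. by rewrite size_map size_enum_ord. Qed.

(** Matches the deletions in [bdsE] with the cofaces in the singular boundary. *)
Lemma face_verts n i : (i < n.+2)%N ->
  take i (verts n.+1) ++ drop i.+1 (verts n.+1) =
  map (@coface R n (inord i)) (verts n).
Proof.
move=> iln; apply: (@eq_from_nth _ (vert R ord0)) => [|k].
  by rewrite size_cat size_take size_drop size_map !size_verts iln subSS subnKC.
rewrite size_cat size_take size_drop size_verts iln subSS subnKC // => kn.
have vE m l : (l < m.+1)%N -> nth (vert R ord0) (verts m) l = vert R (inord l).
  move=> lm; rewrite (nth_map ord0) ?size_enum_ord //; congr vert.
  by apply: val_inj; rewrite /= nth_enum_ord // inordK.
rewrite (nth_map (vert R ord0)) ?size_verts // vE // coface_vert.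
rewrite nth_cat size_take size_verts iln.
have -> : fintype.lift (inord i : 'I_n.+2) (inord k : 'I_n.+1) =
    inord (bump i k).
  have bk : (bump i k < n.+2)%N.
    by rewrite /bump; case: (i <= k)%N; rewrite ?add1n ?add0n ltnS // ltnW.
  by apply: val_inj; rewrite /= !inordK.
rewrite /bump; case: (ltnP k i) => ki.
  by rewrite nth_take // vE // (ltn_trans ki).
by rewrite nth_drop addSn subnKC // vE.
Qed.

Section Phi.
Variable N : nat.

Definition label_subdivs n (g : sing_simplex R X n) : {free (seq P)} :=
  mapc (label \o g) (sdiv (@bary R n) N n.+1 <[verts n]>).

Definition label_subdiv n : sing_chain R X n -> {free (seq P)} :=
  lin (@label_subdivs n).
HB.instance Definition _ n := GRing.Additive.on (@label_subdiv n).

Lemma label_subdivU n g : @label_subdiv n << g >> = label_subdivs g.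
Proof. exact: linU. Qed.

Lemma sing_boundaryU n (g : sing_simplex R X n.+1) :
  sing_boundary << g >> =
  \sum_(i < n.+2) (<< face i g >> : sing_chain R X n) *~ (-1) ^+ i.
Proof.
rewrite /sing_boundary liftU scale1r; apply: eq_bigr => i _.
by rewrite -[(-1) ^+ i]intz scaler_int intz.
Qed.

(** Labelling and subdividing commute with the boundary, and by naturality the subdivided faces of
    the standard simplex label the faces of the singular simplex. *)
Lemma bd_label_subdiv n (y : sing_chain R X n.+1) :
  bd (label_subdiv y) = label_subdiv (sing_boundary y).
Proof.
elim/free_ind: y => [|x y hx hy|g]; first by rewrite !raddf0.
  by rewrite !raddfB /= hx hy.
rewrite label_subdivU /label_subdivs bd_mapc bd_sdiv; last first.
  by apply: suppU; exact: size_verts.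
rewrite bdU bdsE size_verts sing_boundaryU !raddf_sum.
apply: eq_bigr => i _; rewrite !raddfMz /= label_subdivU /label_subdivs face_verts //.
rewrite -mapcU -(mapc_sdiv (b := @bary R n)); last exact: coface_bary.
rewrite mapc_comp; congr (mapc _ _ *~ _).
by apply/funext => x /=; rewrite inord_val.
Qed.

(** Singular chains stop at degree 0, where the boundary of the labels records the augmentation as
    the coefficient of the empty sequence. *)
Lemma bd_label_subdiv0 (y : sing_chain R X 0) :
  bd (label_subdiv y) = <[[::]]> *~ lin (fun=> 1) y.
Proof.
elim/free_ind: y => [|x y hx hy|g]; first by rewrite !raddf0 ?mulr0z.
  by rewrite !raddfB /= hx hy.
rewrite label_subdivU /label_subdivs bd_mapc bd_sdiv; last first.
  by apply: suppU; exact: size_verts.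
rewrite linU mulr1z bdU.
have -> : bds (verts 0) = <[[::]]>.
  case E : (verts 0) (size_verts 0) => [|a [|//]] // _.
  by rewrite -bdU bdU /bds raddf0 subr0.
have -> k : sdiv (@bary R 0) k 0 <[[::]]> = <[[::]]>.
  by elim: k => [//|k IH]; rewrite /sdiv in IH *; rewrite iterS IH conem0.
by rewrite mapcU.
Qed.

Lemma supp_label_subdivs_size n (g : sing_simplex R X n) :
  supp (fun t => size t = n.+1) (label_subdivs g).
Proof.
apply: (@supp_lin _ _ (fun t => size t = n.+1)) => [s sn|].
  by apply: suppU; rewrite size_map.
apply: supp_sdiv_size; apply: suppU; exact: size_verts.
Qed.

End Phi.
End Comparison.

(** * Labels of fine subdivisions form chains *)

Section Small.
Variables (R : realType) (d : Order.disp_t) (P : finPOrderType d).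
Local Notation X := (poset_realization R P).
Local Notation Delta n := (std_simplex R n).

Lemma sing_unif_cont n (g : sing_simplex R X n) : exists2 r : R, 0 < r &
  forall x y : Delta n, (forall i, `|val x i - val y i| < r) ->
    forall u, `|val (g x) u - val (g y) u| < label_bound R P.
Proof.
have cg u : continuous (fun x => val (g x) u).
  apply: (@realization_coord_continuous R (Delta n) P
    (@realization_set R P (order_complex P)) g u).
  exact: cts_fun.
have H : \forall r \near (0 : R)^'+, forall u (x y : Delta n),
    (forall i, `|val x i - val y i| < r) ->
    `|val (g x) u - val (g y) u| < label_bound R P.
  apply: (@filter_forall _ P (fun u r => forall x y : Delta n,
    (forall i, `|val x i - val y i| < r) ->
    `|val (g x) u - val (g y) u| < label_bound R P)) => u.
  have [r r0 rP] := simplex_unif_cont (label_bound_gt0 R P) (cg u).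
  near=> e => x y xy; apply: rP => i; apply: lt_trans (xy i) _.
  near: e; exact: nbhs_right_lt.
have [r [r0 rP]] : exists r : R, 0 < r /\ forall u (x y : Delta n),
    (forall i, `|val x i - val y i| < r) ->
    `|val (g x) u - val (g y) u| < label_bound R P.
  apply: (@filter_ex _ ((0 : R)^'+)); apply: filterI => //.
  exact: nbhs_right_gt.
by exists r => // x y xy u; exact: rP.
Unshelve. all: by end_near.
Qed.

(** On a small piece each coordinate of [g] varies by less than [label_bound]. The coordinate at the
    label of [g y] is thus still positive at [g x], so both labels lie in the support of the single
    point [g x], which is a chain. *)
Lemma label_subdivs_small n (g : sing_simplex R X n) :
  exists N0, forall N, (N0 <= N)%N -> supp (@pchain _ P) (label_subdivs N g).
Proof.
have [r r0 rP] := sing_unif_cont g.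
(* The factor by which one barycentric subdivision shrinks the mesh of an [n]-simplex. *)
set q : R := 1 - n.+1%:R^-1.
have q0 : 0 <= q by rewrite subr_ge0 invf_le1 ?ltr0n // ler1n.
have q1 : `|q| < 1 by rewrite ger0_norm // gtrBl invr_gt0 ltr0n.
have /cvgrPdist_lt/(_ r r0)[N0 _ N0P] := cvg_expr q1.
exists N0 => N /N0P /=; rewrite sub0r normrN ger0_norm ?exprn_ge0 // => qN.
apply: (@supp_mapc _ _ _
    (fun t => forall i, osc (fun x : Delta n => val x i) (q ^+ N * 1) t)).
  move=> t ot a b /mapP[x xt ->] /mapP[y yt ->] /=.
  apply: (@realization_comparable _ _ _ (g x)); first exact: label_neq0.
  rewrite mulr1 in ot; have := rP x y.
  move=> /(_ (fun i => le_lt_trans (ot i x y xt yt) qN) (label (g y))).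
  rewrite ltr_distl => /andP[+ _] => lt0; rewrite gt_eqF //; move: lt0.
  by apply: le_lt_trans; rewrite subr_ge0 labelP.
move=> t tN i.
apply: (@sdiv_osc _ (@bary R n) R (fun x => val x i) _ n n.+1 N 1
  <[verts R n]> (leqnn _) _) tN => //.
apply: suppU; split; first exact: size_verts.
move=> x y /mapP[j _ ->] /mapP[k _ ->] /=; rewrite /vert_fun.
by do 2 case: eqP => _; rewrite ?subrr ?subr0 ?sub0r ?normrN ?normr0 ?normr1.
Qed.

Lemma label_subdiv_small n (y : sing_chain R X n) :
  exists N0, forall N, (N0 <= N)%N -> supp (@pchain _ P) (label_subdiv N y).
Proof.
elim/free_ind: y => [|x y [M hx] [N hy]|g].
- by exists 0%N => N _; rewrite raddf0; exact: supp0.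
- exists (maxn M N) => k; rewrite geq_max => /andP[Mk Nk].
  by rewrite raddfB; apply: suppB; [exact: hx | exact: hy].
- have [N0 N0P] := label_subdivs_small g.
  by exists N0 => N /N0P; rewrite label_subdivU.
Qed.

End Small.

(** * Singular against simplicial chains *)

Section HomologyClass.
Variables (C : nat -> zmodType) (d : forall n, {additive C n.+1 -> C n}).

Definition hclass n (c : cycles d n) : homology d n :=
  \pi_(homology d n)%qT c.

Fact hclass_is_additive n : zmod_morphism (@hclass n).
Proof. by move=> x y; exact: raddfB. Qed.
HB.instance Definition _ n :=
  GRing.isZmodMorphism.Build (cycles d n) (homology d n) (@hclass n)
    (@hclass_is_additive n).

Lemma hclass_eq0 n (c : cycles d n) : hclass c = 0 ->
  exists b, d n b = val c.
Proof.
move=> c0; have : c - 0 \in @boundary_pred C d n.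
  rewrite Quotient.idealrBE; apply/eqP.
  by rewrite [LHS]c0 -[LHS](raddf0 (@hclass n)).
by rewrite subr0 unfold_in => /asboolP.
Qed.

Lemma hclass_surj n (h : homology d n) : exists c, h = hclass c.
Proof. by exists (repr h); rewrite /hclass reprK. Qed.

End HomologyClass.

(** * Decreasing sequences as affine singular simplices *)

Section Realize.
Variables (R : realType) (d : Order.disp_t) (P : finPOrderType d).
Local Notation X := (poset_realization R P).
Local Notation Delta n := (std_simplex R n).

Section AffineSimplex.
Variables (n : nat) (w : 'I_n.+1 -> P).
Hypothesis wc : forall i j, (w i >=< w j)%O.

(** Push-forward of barycentric coordinates along the vertex map [w]: the weights of repeated
    vertices add up. *)
Definition affine_fun (x : Delta n) : P -> R :=
  fun u => \sum_(j | w j == u) val x j.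

Lemma affine_in (x : Delta n) :
  affine_fun x \in @realization_set R P (order_complex P).
Proof.
have [x0 x1] : @simplex_set R _ (val x) by case: x => x /= /set_mem.
have s1 : \sum_u affine_fun x u = 1.
  by rewrite -x1 (partition_big w predT).
have supw u : affine_fun x u != 0 -> exists j, w j = u.
  move=> xu; apply: contrapT => /forallNP wu; move: xu.
  rewrite /affine_fun big_pred0 ?eqxx // => j.
  by apply/negP => /eqP; exact: wu.
apply/mem_set; split; first by split=> // u; exact: sumr_ge0.
rewrite inE; apply/andP; split.
  apply/negP => /eqP s0; have /eqP := s1.
  rewrite big1 ?(eq_sym 0) ?oner_eq0 // => u _; apply/eqP/negPn/negP => xu.
  have : u \in [set v | affine_fun x v != 0]%SET by rewrite inE.
  by rewrite s0 inE.
apply/forall_inP => u; rewrite inE => /supw[i <-].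
by apply/forall_inP => v; rewrite inE => /supw[j <-].
Qed.

Definition affine (x : Delta n) : X := exist _ (affine_fun x) (affine_in x).

Lemma affine_continuous : continuous affine.
Proof.
apply: (@realization_continuous R (Delta n) P
  (@realization_set R P (order_complex P))) => u /=.
have -> : (fun x : Delta n => affine_fun x u) =
    (fun x : Delta n =>
      \sum_(j <- [seq j <- index_enum 'I_n.+1 | w j == u]) val x j).
  by apply/funext => x; rewrite /affine_fun big_filter.
apply: sum_continuous => j.
exact: (@realization_coord_continuous R (Delta n) _
  (@simplex_set R 'I_n.+1) idfun j (fun=> cvg_id)).
Qed.

Definition affine_simplex : sing_simplex R X n := mkcts affine_continuous.

(** A label has a nonzero coordinate, and on an affine simplex only the vertices in the image of [w]
    do. This is why the approximation below is carried by the entries of a sequence. *)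
Lemma label_affine x : exists j, label (affine_simplex x) = w j.
Proof.
have := label_neq0 (affine_simplex x); set u := label _ => xu.
apply: contrapT => /forallNP wu; move: xu => /=.
rewrite /affine_fun big_pred0 ?eqxx // => j.
by apply/negP => /eqP uj; exact: (wu j).
Qed.

End AffineSimplex.

Lemma eq_affine n (w w' : 'I_n.+1 -> P) wc wc' : w =1 w' ->
  affine_simplex (w := w) wc = affine_simplex (w := w') wc'.
Proof.
move=> /funext ww'; case: _ / ww' wc' => wc'.
by congr affine_simplex; exact: Prop_irrelevance.
Qed.

Lemma face_affine n (w : 'I_n.+2 -> P) wc i :
  face i (affine_simplex (w := w) wc) =
  affine_simplex (w := w \o fintype.lift i) (fun j k => wc _ _).
Proof.
apply/continuousEP => x; apply: val_inj; apply/funext => u /=.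
rewrite /affine_fun /= big_mkcond /= (bigD1_ord i) //= /coface_fun unlift_none.
rewrite if_same add0r [RHS]big_mkcond; apply: eq_bigr => j _.
by rewrite liftK.
Qed.

(* Sequences that are not chains are sent to 0. *)
Definition realizes n (s : seq P) : sing_chain R X n :=
  if s is a :: _ then
    if pselect (forall i j : 'I_n.+1, (nth a s i >=< nth a s j)%O) is left h
    then << affine_simplex h >> else 0
  else 0.

Definition realize n : {free (seq P)} -> sing_chain R X n := lin (realizes n).
HB.instance Definition _ n := GRing.Additive.on (realize n).

Lemma realizeE n s a (h : forall i j : 'I_n.+1, (nth a s i >=< nth a s j)%O) :
  size s = n.+1 -> realize n <[s]> = << affine_simplex h >>.
Proof.
rewrite /realize linU; case: s h => [//|b s] h sn; rewrite /realizes.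
have nE (i : 'I_n.+1) : nth b (b :: s) i = nth a (b :: s) i.
  by apply: set_nth_default; rewrite sn.
case: pselect => [h'|[]]; first by congr << _ >>; exact: eq_affine.
by move=> i j; rewrite !nE.
Qed.

Lemma dec_comparable n (s : seq P) a : dec n s ->
  forall i j, (i < n)%N -> (j < n)%N -> (nth a s i >=< nth a s j)%O.
Proof.
move=> [ss <-] i j iln jln.
have tr : transitive (fun x y : P => (y <= x)%O).
  by move=> x y z xy yz; exact: le_trans yz xy.
have rf : reflexive (fun x y : P => (y <= x)%O) by move=> x /=; exact: lexx.
have le := sorted_leq_nth tr rf a ss.
by case/orP: (leq_total i j) => ij; apply/orP; [right|left]; apply: le.
Qed.

Lemma sing_boundary_realize n s : dec n.+2 s ->
  sing_boundary (realize n.+1 <[s]>) = realize n (bds s).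
Proof.
move=> ds; have a : P by case: s ds => [[]|].
have sn := ds.2.
have cs i j : (i < n.+2)%N -> (j < n.+2)%N -> (nth a s i >=< nth a s j)%O.
  exact: (dec_comparable a ds).
rewrite (@realizeE _ _ a (fun i j => cs i j (ltn_ord i) (ltn_ord j))) //.
rewrite sing_boundaryU bdsE sn raddf_sum; apply: eq_bigr => i _.
rewrite raddfMz /=; congr (_ *~ _).
pose t := take i s ++ drop i.+1 s.
have tE (j : 'I_n.+1) : nth a t j = nth a s (fintype.lift i j).
  rewrite nth_cat size_take sn ltn_ord /= /bump; case: (ltnP j i) => ij.
    by rewrite nth_take.
  by rewrite nth_drop addSn subnKC.
have tc : forall j k : 'I_n.+1, (nth a t j >=< nth a t k)%O.
  by move=> j k; rewrite !tE; apply: cs.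
rewrite (realizeE tc); last first.
  by rewrite size_cat size_take size_drop sn ltn_ord subSS subnKC // -ltnS.
by rewrite face_affine; congr << _ >>; apply: eq_affine => j; rewrite tE.
Qed.

Lemma supp_label_subdiv_realize N n s : dec n.+1 s ->
  supp (fun t => size t = n.+1 /\ {subset t <= s})
    (label_subdiv N (realize n <[s]>)).
Proof.
move=> ds; have a : P by case: s ds => [[]|].
have cs i j : (i < n.+1)%N -> (j < n.+1)%N -> (nth a s i >=< nth a s j)%O.
  exact: (dec_comparable a ds).
rewrite (@realizeE _ _ a (fun i j => cs i j (ltn_ord i) (ltn_ord j))) ?ds.2 //.
rewrite label_subdivU => t tp; split; first exact: supp_label_subdivs_size tp.
move: t tp; apply: (@supp_mapc _ _ _ (fun=> True)) => // t _ u /mapP[x _ ->].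
have [j jE] := label_affine (fun i j => cs i j (ltn_ord i) (ltn_ord j)) x.
by rewrite [X in X \in _](_ : _ = nth a s j) ?mem_nth ?ds.2.
Qed.

Lemma realize_eps n y : supp (dec n.+1) y ->
  lin (fun=> 1 : int) (realize n y) = lin (fun=> 1) y.
Proof.
elim/supp_ind => [|u v hu hv|s ds]; first by rewrite !raddf0.
  by rewrite !raddfB /= hu hv.
have a : P by case: s ds => [[]|].
have cs i j : (i < n.+1)%N -> (j < n.+1)%N -> (nth a s i >=< nth a s j)%O.
  exact: (dec_comparable a ds).
rewrite (@realizeE _ _ a (fun i j => cs i j (ltn_ord i) (ltn_ord j))) ?ds.2 //.
by rewrite !linU.
Qed.

End Realize.

(** * Acyclicity of the simplicial chains *)

Section PointAcyclic.
Variables (R : realType) (d : Order.disp_t) (P : finPOrderType d).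
Local Notation X := (poset_realization R P).
Local Notation L := {free (seq P)}.

Lemma supp_sortc_chain n (y : L) :
  supp (fun s => pchain s /\ size s = n) y -> supp (dec n) (sortc n y).
Proof.
apply: supp_lin => s [cs sn]; rewrite -conemU.
by apply: (suppW _ (@supp_sortc _ _ n s cs sn)) => t [].
Qed.

Section Approximation.
Variable N : nat.

(** Realize, subdivide, label, sort. Since [n] counts entries, the singular degree is [m], one less;
    on the empty sequence the map is the identity. *)
Definition approxs n (s : seq P) : L :=
  if n is m.+1 then sortc n (label_subdiv N (realizes R m s)) else <[s]>.

Definition approx n : L -> L := lin (approxs n).
HB.instance Definition _ n := GRing.Additive.on (approx n).

Lemma approxE n y : approx n.+1 y = sortc n.+1 (label_subdiv N (realize R n y)).
Proof.
elim/free_ind: y => [|x y hx hy|s]; first by rewrite !raddf0.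
  by rewrite !raddfB /= hx hy.
by rewrite /approx /realize !linU.
Qed.

Lemma approx0 : approx 0 <[[::]]> = <[[::]]>.
Proof. exact: linU. Qed.

Lemma label_subdiv_realize_chain n (s : seq P) : dec n.+1 s ->
  supp (fun t => (pchain t /\ size t = n.+1) /\ {subset t <= s})
    (label_subdiv N (realize R n <[s]>)).
Proof.
move=> ds; apply: (suppW _ (@supp_label_subdiv_realize R d P N n s ds)) => t [tn ts].
split=> //; split=> // u v /ts us /ts vs.
have := dec_comparable u ds; rewrite -ds.2 => cs.
rewrite -(nth_index u us) -(nth_index u vs).
by apply: cs; rewrite index_mem.
Qed.

Lemma approx_supp n (s : seq P) : dec n s ->
  supp (fun t => dec n t /\ {subset t <= s}) (approx n <[s]>).
Proof.
case: n => [|n] ds; first by rewrite /approx linU; apply: suppU; split.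
rewrite approxE.
apply: supp_lin (@label_subdiv_realize_chain n s ds) => t [[tc tn] ts].
rewrite -conemU; apply: (suppW _ (@supp_sortc _ _ n.+1 t tc tn)) => u [du ut].
by split=> // v /ut /ts.
Qed.

Lemma approx_bd n (s : seq P) : dec n.+1 s ->
  bd (approx n.+1 <[s]>) = approx n (bds s).
Proof.
move=> ds; rewrite approxE /sortc bd_conem; last first.
  by apply: (suppW _ (@label_subdiv_realize_chain n s ds)) => t [[]].
case: n ds => [|n] ds; last first.
  by rewrite bd_label_subdiv sing_boundary_realize // approxE.
rewrite bd_label_subdiv0 realize_eps; last exact: suppU.
rewrite linU mulr1z conem0.
case: s ds => [|a [|? ?]] [_ //] _.
by rewrite -bdU bdU /bds raddf0 subr0 approx0.
Qed.

Lemma approx_htpy n z : supp (dec n) z -> bd z = 0 ->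
  exists2 w, supp (dec n.+1) w & bd w = z - approx n z.
Proof.
by apply: (htpy_bd (Psi := approx)) => //;
  [exact: approx_bd | exact: approx0 | exact: approx_supp].
Qed.

End Approximation.

(** Sorting the labels of a fine subdivision of [b] fills [approx N n z], and the homotopy fills the
    difference to [z]. The number [N] depends on [b], so the homotopy is needed for every [N]. *)
Lemma realize_boundary n z (b : sing_chain R X n.+1) : supp (dec n.+1) z ->
  bd z = 0 -> sing_boundary b = realize R n z ->
  exists2 w, supp (dec n.+2) w & bd w = z.
Proof.
move=> zn bz bb; have [N /(_ N (leqnn N)) bN] := label_subdiv_small b.
have [w wn bw] := approx_htpy N zn bz.
have bs : supp (fun s => pchain s /\ size s = n.+2) (label_subdiv N b).
  have sN : supp (fun s : seq P => size s = n.+2) (label_subdiv N b).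
    apply: (@supp_lin _ _ (fun=> True)) => // g _; exact: supp_label_subdivs_size.
  by move=> t tb; split; [exact: bN | exact: sN].
exists (w + sortc n.+2 (label_subdiv N b)).
  by apply: suppD => //; exact: supp_sortc_chain.
rewrite raddfD /= bw [bd (sortc _ _)]bd_conem; last first.
  by apply: suppW bs => t [].
by rewrite bd_label_subdiv bb -/(sortc _ _) -approxE subrK.
Qed.

(** Read off from [bd_bd] on labels; any number of subdivisions serves, here 0. *)
Lemma eps_boundary (b : sing_chain R X 1) :
  lin (fun=> 1 : int) (sing_boundary b) = 0.
Proof.
have := bd_label_subdiv0 0 (sing_boundary b).
rewrite -bd_label_subdiv bd_bd => /esym.
move=> /(congr1 (lin (fun=> 1 : int))); rewrite raddfMz /= linU raddf0.
by rewrite intz.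
Qed.

Hypothesis hX : has_homology_of_point R X.

(** The isomorphism of degree 0 homology with the integers is not assumed to be the augmentation.
    With [c0] a representative of the preimage of 1, each 0-chain is homologous to a multiple of
    [c0], so its augmentation is a multiple of [eps (val c0)]. A point has augmentation 1, so this
    number is nonzero and a chain of augmentation 0 is homologous to 0. *)
Lemma point_H0 : (exists p : P, True) /\
  (forall c : sing_chain R X 0, lin (fun=> 1 : int) c = 0 ->
  exists b, sing_boundary b = c).
Proof.
have [[f [g fK gK]] _] := hX.
pose sb := fun m => @sing_boundary R X m : {additive _ -> _}.
have cyc (c : sing_chain R X 0) : c \in @cycle_pred _ sb 0.
  by rewrite unfold_in; apply/asboolP.
have [c0 c0E] := hclass_surj (g 1).
have main (c : sing_chain R X 0) : exists (m : int) b,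
    sing_boundary b = c - val c0 *~ m.
  pose m : int := f (hclass (Cycle (cyc c))).
  have : hclass (Cycle (cyc c) - c0 *~ m) = 0.
    apply: (can_inj fK); rewrite !raddfB !raddfMz /= -c0E gK raddf0.
    by rewrite mulNrz intz subrr.
  by move=> /hclass_eq0[b]; rewrite raddfB raddfMz /= => bE; exists m, b.
pose eps : sing_chain R X 0 -> int := lin (fun=> 1).
have epsE (c : sing_chain R X 0) m b :
    sing_boundary b = c - val c0 *~ m -> eps c = eps (val c0) * m.
  move=> bE; have := eps_boundary b; rewrite bE raddfB raddfMz /= => /subr0_eq.
  by rewrite -/eps -mulrzr intz.
(* Without singular simplices [c0] would be 0, hence 1 = [f (g 1)] = 0. *)
have [g0 _] : exists g0 : sing_simplex R X 0, True.
  apply: contrapT => ng.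
  suff c00 : val c0 = 0.
    have : g 1 = 0.
      by rewrite c0E (_ : c0 = 0) ?raddf0 //; exact: val_inj.
    by move=> /(congr1 f); rewrite gK raddf0.
  apply/eqP; rewrite -dom_eq0; case: (dom _) => [//|h ?].
  by case: ng; exists h.
split; first by exists (label (g0 (vert R ord0))).
have e0 : eps (val c0) != 0.
  have [m [b /epsE]] := main << g0 >>; rewrite /eps linU => /esym e1.
  by apply: contraPneq e1 => ->; rewrite mul0r.
move=> c ec; have [m [b bE]] := main c; exists b.
have := epsE _ _ _ bE; rewrite [eps c]ec => /esym/eqP.
rewrite mulf_eq0 (negPf e0) => /eqP m0.
by rewrite bE m0 mulr0z subr0.
Qed.

(** By degree: multiples of the empty sequence are coned from a vertex; vertices of total
    augmentation 0 bound singularly by [point_H0]; in positive degree the realization is a singular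
    cycle, which bounds by hypothesis. *)
Theorem point_acyclic n (z : L) : supp (dec n) z -> bd z = 0 ->
  exists2 w, supp (dec n.+1) w & bd w = z.
Proof.
have [[p _] H0] := point_H0.
case: n => [|[|n]] zn bz.
- exists (cone p z); last by rewrite bd_cone bz raddf0 subr0.
  apply: supp_cone zn => s [_ sn]; split; last by rewrite /= sn.
  by case: s sn.
- have [|b bb] := H0 (realize R 0 z); last exact: realize_boundary bb.
  by rewrite realize_eps // -lin1_bd // bz raddf0.
have c0 : sing_boundary (realize R n.+1 z) = 0.
  suff -> : sing_boundary (realize R n.+1 z) = realize R n (bd z).
    by rewrite bz raddf0.
  elim/supp_ind: zn => [|u v hu hv|s ds]; first by rewrite !raddf0.
    by rewrite !raddfB /= hu hv.
  by rewrite sing_boundary_realize // bdU.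
have cz : realize R n.+1 z \in
    @cycle_pred _ (fun m => @sing_boundary R X m : {additive _ -> _}) n.+1.
  by rewrite unfold_in; apply/asboolP.
have [b bb] := hclass_eq0 (hX.2 n.+1 isT (hclass (Cycle cz))).
exact: realize_boundary bb.
Qed.

End PointAcyclic.

(** * Diagram chasing with epimorphic refinements *)

Section Calculus.
Variable V : abelianCat.
Implicit Types X Y Z W : V.

Lemma epi_comp X Y Z (f : hom X Y) (g : hom Y Z) :
  epi f -> epi g -> epi (g \oc f).
Proof. by move=> ef eg W u v; rewrite !cmpA => /ef /eg. Qed.

Lemma epi_of_comp X Y Z (f : hom X Y) (g : hom Y Z) : epi (g \oc f) -> epi g.
Proof. by move=> egf W u v uv; apply: egf; rewrite !cmpA uv. Qed.

Lemma epi_idm X : epi (idm X).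
Proof. by move=> W u v; rewrite !cmpm1. Qed.

Lemma epi_cokernel X Y (f : hom X Y) : epi f -> is_cokernel (kerm f) f.
Proof.
move=> ef; have [Z [g gf]] := ab_epi (abP V) ef.
exact: epi_cokernel_kernel gf (kermP f).
Qed.

(** The pullback is the kernel of [g = f p1 - z p2]. As [g] is the cokernel of that kernel, a map
    killing the pulled back leg factors through [g] by a map that vanishes on [f], hence is 0. *)
Lemma epi_pullback X Y Z (f : hom X Y) (z : hom Z Y) : epi f ->
  exists W (e : hom W Z) (x : hom W X), epi e /\ f \oc x = z \oc e.
Proof.
move=> ef.
have [B [i1 [i2 [p1 [p2 [e11 e22 e12 e21 e]]]]]] := ab_biproduct (abP V) X Z.
pose g := f \oc p1 - z \oc p2.
have gi1 : g \oc i1 = f by rewrite cmpBl -!cmpA e11 e21 cmpm1 cmpm0 subr0.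
have eg : epi g by apply: (@epi_of_comp _ _ _ i1); rewrite gi1.
have [gk gu] := epi_cokernel eg.
exists (ker g), (p2 \oc kerm g), (p1 \oc kerm g); split; last first.
  by apply/eqP; rewrite -subr_eq0 !cmpA -cmpBl (kermP g).1.
apply/epi0P => U u; rewrite cmpA => /gu[v [vg _]].
have v0 : v = 0.
  by apply: ef; rewrite -gi1 cmpA vg -cmpA e21 cmpm0 cmp0m.
by rewrite -(cmpm1 u) -e22 cmpA -vg v0 !cmp0m.
Qed.

(** Factoring through a monomorphism may be checked after an epimorphism: [w] kills the kernel of
    [e] because [f] is mono, so it descends along [e]. *)
Lemma mono_epi_lift X Y Z W (f : hom X Y) (e : hom W Z) (z : hom Z Y)
    (w : hom W X) : mono f -> epi e -> f \oc w = z \oc e ->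
  exists v, f \oc v = z.
Proof.
move=> mf ee fw; have [ek eu] := epi_cokernel ee.
have wk : w \oc kerm e = 0.
  by move/mono0P: mf; apply; rewrite cmpA fw -cmpA (kermP e).1 cmpm0.
have [v [ve _]] := eu _ _ wk; exists v.
by apply: ee; rewrite -cmpA ve.
Qed.

Lemma kernelP X Y Z (f : hom X Y) (g : hom Y Z) : mono f -> g \oc f = 0 ->
  (forall T (t : hom T Y), g \oc t = 0 ->
    exists W (e : hom W T) (w : hom W X), epi e /\ f \oc w = t \oc e) ->
  is_kernel g f.
Proof.
move=> mf gf loc; split=> // T t /loc[W [e [w [ee fw]]]].
have [v fv] := mono_epi_lift mf ee fw; exists v; split=> // v' fv'.
by apply: mf; rewrite fv.
Qed.

Lemma epi_of_local X Y (f : hom X Y) W (e : hom W Y) (w : hom W X) :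
  epi e -> f \oc w = e -> epi f.
Proof. by move=> ee fw; apply: (@epi_of_comp _ _ _ w); rewrite fw. Qed.

Lemma exact_lift X Y Z (f : hom X Y) (g : hom Y Z) T (t : hom T Y) :
  exact f g -> g \oc t = 0 ->
  exists W (e : hom W T) (w : hom W X), epi e /\ f \oc w = t \oc e.
Proof.
move=> [K [k [u [[gk ku] <- eu]]]] /ku[v [<- _]].
have [W [e [w [ee uw]]]] := epi_pullback v eu.
by exists W, e, w; split=> //; rewrite -!cmpA uw.
Qed.

Lemma cokerm_lift X Y (f : hom X Y) T (t : hom T Y) : cokerm f \oc t = 0 ->
  exists W (e : hom W T) (w : hom W X), epi e /\ f \oc w = t \oc e.
Proof.
move=> ct; have m1 : mono (idm (coker f)) by move=> Z u v; rewrite !cmp1m.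
by apply: exact_lift (exact_cokerm m1) _; rewrite cmp1m.
Qed.

(** Successive pullbacks give finitely many refinements a common one. *)
Lemma fin_local (I : finType) T (Q : I -> forall W, hom W T -> Prop) :
  (forall i W (e : hom W T) W' (e' : hom W' W), Q i W e -> Q i W' (e \oc e')) ->
  (forall i, exists W (e : hom W T), epi e /\ Q i W e) ->
  exists W (e : hom W T), epi e /\ forall i, Q i W e.
Proof.
move=> Qc Qe.
suff [W [e [ee eQ]]] : exists W (e : hom W T), epi e /\
    forall i, i \in enum I -> Q i W e.
  by exists W, e; split=> // i; apply: eQ; rewrite mem_enum.
elim: (enum I) => [|i r [W [e [ee eQ]]]].
  by exists T, (idm T); split=> //; exact: epi_idm.
have [W1 [e1 [ee1 eQ1]]] := Qe i.
have [W2 [e2 [x [ee2 xe]]]] := epi_pullback e ee1.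
exists W2, (e \oc e2); split; first exact: epi_comp.
move=> k; rewrite inE => /predU1P[->|/eQ]; last exact: Qc.
by rewrite -xe; exact: Qc.
Qed.

Lemma epi_isomorphic W H H' (p : hom W H) (q : hom W H') : epi p -> epi q ->
  (forall Z (w : hom Z W), p \oc w = 0 <-> q \oc w = 0) -> isomorphic H H'.
Proof.
move=> ep eq pq.
have qp0 : q \oc kerm p = 0 by apply/pq; exact: (kermP p).1.
have pq0 : p \oc kerm q = 0 by apply/pq; exact: (kermP q).1.
have [v [vp _]] := (epi_cokernel ep).2 _ _ qp0.
have [u [uq _]] := (epi_cokernel eq).2 _ _ pq0.
exists v, u; split.
  by apply: ep; rewrite -cmpA vp uq cmp1m.
by apply: eq; rewrite -cmpA uq vp cmp1m.
Qed.

Lemma mono_isomorphic Y K K' (m : hom K Y) (m' : hom K' Y) :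
  mono m -> mono m' -> (exists u, m' \oc u = m) -> (exists u, m \oc u = m') ->
  isomorphic K K'.
Proof.
move=> mm mm' [u mu] [v mv]; exists u, v; split.
  by apply: mm; rewrite cmpA mv mu cmpm1.
by apply: mm'; rewrite cmpA mu mv cmpm1.
Qed.

Lemma isomorphic_sym X Y : isomorphic X Y -> isomorphic Y X.
Proof. by move=> [f [g [gf fg]]]; exists g, f. Qed.

Lemma isomorphic_trans X Y Z : isomorphic X Y -> isomorphic Y Z ->
  isomorphic X Z.
Proof.
move=> [f [g [gf fg]]] [f' [g' [gf' fg']]].
exists (f' \oc f), (g \oc g'); split.
  by rewrite -cmpA (cmpA g') gf' cmp1m gf.
by rewrite -cmpA (cmpA f) fg cmp1m fg'.
Qed.

(* Cohomology objects are compared through a span of cocycles w, w' that meets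
   all classes on both sides and whose two legs bound simultaneously. *)
Section Span.
Variables (X Y Z X' Y' Z' W : V).
Variables (f : hom X Y) (g : hom Y Z) (f' : hom X' Y') (g' : hom Y' Z').
Hypotheses (gf : g \oc f = 0) (gf' : g' \oc f' = 0).
Variables (w : hom W Y) (w' : hom W Y').
Hypotheses (gw : g \oc w = 0) (gw' : g' \oc w' = 0).

Let p := cokerm (ker_lift gf) \oc ker_lift gw.

Lemma span_zero T (t : hom T W) : p \oc t = 0 <->
  exists U (e : hom U T) (x : hom U X), epi e /\ f \oc x = w \oc t \oc e.
Proof.
split.
  rewrite /p -cmpA => /cokerm_lift[U [e [x [ee xe]]]].
  exists U, e, x; split=> //.
  by rewrite -[X in X \oc x](ker_liftE gf) -[X in X \oc t](ker_liftE gw) -cmpA xe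
    !cmpA.
move=> [U [e [x [ee fx]]]]; apply: ee; rewrite cmp0m /p.
have -> : cokerm (ker_lift gf) \oc ker_lift gw \oc t \oc e =
    cokerm (ker_lift gf) \oc (ker_lift gf \oc x).
  rewrite -!cmpA; congr (_ \oc _); apply: (kernel_mono (kermP g)).
  by rewrite !cmpA !ker_liftE fx.
by rewrite cmpA (cokermP _).1 cmp0m.
Qed.

Lemma span_epi :
  (forall T (y : hom T Y), g \oc y = 0 ->
    exists U (e : hom U T) (t : hom U W), epi e /\ w \oc t = y \oc e) -> epi p.
Proof.
move=> H; have [U [e [t [ee wt]]]] := H _ _ (kermP g).1.
apply: (@epi_of_comp _ _ _ t); rewrite /p -cmpA.
have -> : ker_lift gw \oc t = e.
  by apply: (kernel_mono (kermP g)); rewrite cmpA ker_liftE.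
by apply: epi_comp => //; exact: cokernel_epi (cokermP _).
Qed.

End Span.

Lemma span_isomorphic X Y Z X' Y' Z' W
    (f : hom X Y) (g : hom Y Z) (f' : hom X' Y') (g' : hom Y' Z')
    (gf : g \oc f = 0) (gf' : g' \oc f' = 0)
    (w : hom W Y) (w' : hom W Y') :
  g \oc w = 0 -> g' \oc w' = 0 ->
  (forall T (y : hom T Y), g \oc y = 0 ->
    exists U (e : hom U T) (t : hom U W), epi e /\ w \oc t = y \oc e) ->
  (forall T (y : hom T Y'), g' \oc y = 0 ->
    exists U (e : hom U T) (t : hom U W), epi e /\ w' \oc t = y \oc e) ->
  (forall T (t : hom T W) (x : hom T X), f \oc x = w \oc t ->
    exists U (e : hom U T) (x' : hom U X'), epi e /\ f' \oc x' = w' \oc t \oc e) ->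
  (forall T (t : hom T W) (x : hom T X'), f' \oc x = w' \oc t ->
    exists U (e : hom U T) (x' : hom U X), epi e /\ f \oc x' = w \oc t \oc e) ->
  isomorphic (coker (ker_lift gf)) (coker (ker_lift gf')).
Proof.
move=> gw gw' sw sw' ww' w'w.
apply: (epi_isomorphic (p := cokerm (ker_lift gf) \oc ker_lift gw)
  (q := cokerm (ker_lift gf') \oc ker_lift gw')) => [||T t].
- exact: span_epi.
- exact: span_epi.
rewrite (span_zero gf gw) (span_zero gf' gw'); split=> -[U [e [x [ee]]]]; rewrite -cmpA.
  move=> /ww'[U' [e' [x' [ee' fx']]]].
  exists U', (e \oc e'), x'; split; first exact: epi_comp.
  by rewrite fx' !cmpA.
move=> /w'w[U' [e' [x' [ee' fx']]]].
exists U', (e \oc e'), x'; split; first exact: epi_comp.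
by rewrite fx' !cmpA.
Qed.

End Calculus.

(** * Cochains of a sheaf *)

Section Cochains.
Context {d : Order.disp_t} {Q : finPOrderType d} {V : abelianCat}.
Local Notation Sh := (sheaf_preadditive Q V).
Local Notation L := {free (seq Q)}.
Implicit Types (A B C : Sh) (x y : Q) (s t : seq Q).

Definition valid n x s : bool :=
  path (fun a b : Q => (b <= a)%O) x s && (size s == n).

Lemma validP n x s : valid n x s <-> dec n.+1 (x :: s).
Proof.
split=> [/andP[xs /eqP sn]|[/= xs [sn]]]; first by split=> //=; rewrite sn.
by rewrite /valid xs sn eqxx.
Qed.

(** A finite product over the valid pairs, with projections extended by 0 to all pairs so that
    formulas carry no validity proofs. *)
Lemma cochains_ex A n : exists C : {C : V & forall x (s : seq Q), hom C (A x)},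
  [/\ forall x s, ~~ valid n x s -> projT2 C x s = 0,
    forall Z (q : forall x (s : seq Q), hom Z (A x)), exists u : hom Z (projT1 C),
      forall x s, valid n x s -> projT2 C x s \oc u = q x s
    & forall Z (u v : hom Z (projT1 C)),
      (forall x s, valid n x s -> projT2 C x s \oc u = projT2 C x s \oc v) ->
      u = v].
Proof.
pose I := {p : Q * n.-tuple Q | valid n p.1 p.2}.
have [P [p pP]] := fin_product (fun i : I => A (val i).1).
have vn x s : valid n x s -> size s == n by case/andP.
pose mk x s (h : valid n x s) : I := exist _ (x, Tuple (vn _ _ h)) h.
pose pr x s : hom P (A x) :=
  if boolP (valid n x s) is AltTrue h then p (mk x s h) else 0.
have prE x s (h : valid n x s) : pr x s = p (mk x s h).
  rewrite /pr; case: {-}_ / boolP => [h'|]; last by rewrite h.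
  by rewrite (Prop_irrelevance h' h).
have prI (i : I) : pr (val i).1 (val i).2 = p i.
  case: i => -[x [t ht]] h /=.
  by rewrite (prE x t h) /mk (Prop_irrelevance (vn _ _ h) ht).
exists (existT _ P pr); split=> [x s nv|Z q|Z u v uv] /=.
- by rewrite /pr; case: {-}_ / boolP => // h; rewrite h in nv.
- have [u [uq _]] := pP Z (fun i : I => q (val i).1 (val i).2).
  by exists u => x s h; rewrite prE; exact: (uq (mk x s h)).
have [w [_ wP]] := pP Z (fun i => p i \oc v).
rewrite -(wP v) // -(wP u) // => i; rewrite -prI.
by apply: uv; case: i.
Qed.

(* The product of the stalks A x over the decreasing sequences x :: s of size
   n.+1; the projection prj A n x s is 0 for other sequences. *)
Definition cch A n : V := projT1 (projT1 (cid (cochains_ex A n))).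
Definition prj A n : forall x (s : seq Q), hom (cch A n) (A x) :=
  projT2 (projT1 (cid (cochains_ex A n))).

Lemma prj_invalid A n x s : ~~ valid n x s -> prj A n x s = 0.
Proof. by have [H _ _] := projT2 (cid (cochains_ex A n)); exact: H. Qed.

Lemma cch_ex A n Z (q : forall x (s : seq Q), hom Z (A x)) :
  exists u : hom Z (cch A n),
    forall x s, valid n x s -> prj A n x s \oc u = q x s.
Proof. by have [_ H _] := projT2 (cid (cochains_ex A n)); exact: H. Qed.

Lemma cch_eq A n Z (u v : hom Z (cch A n)) :
  (forall x s, valid n x s -> prj A n x s \oc u = prj A n x s \oc v) -> u = v.
Proof. by have [_ _ H] := projT2 (cid (cochains_ex A n)); exact: H. Qed.

Section Pairing.
Variables (A : Sh) (n : nat) (J : V) (th : forall x, hom (A x) J).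

(** Evaluation of a cochain on chains: its components lie in different stalks, and [th] carries them
    to the common object [J]. *)
Definition pairing_seq Z (b : hom Z (cch A n)) s : hom Z J :=
  if s is x :: s' then th x \oc prj A n x s' \oc b else 0.

Definition pairing Z (b : hom Z (cch A n)) : L -> hom Z J := lin (pairing_seq b).
HB.instance Definition _ Z b := GRing.Additive.on (@pairing Z b).

Lemma pairingU Z (b : hom Z (cch A n)) s : pairing b <[s]> = pairing_seq b s.
Proof. exact: linU. Qed.

Lemma pairing_cmp Z (b : hom Z (cch A n)) W (e : hom W Z) c :
  pairing b c \oc e = pairing (b \oc e) c.
Proof.
elim/free_ind: c => [|u v hu hv|s]; first by rewrite !raddf0 cmp0m.
  by rewrite !raddfB /= cmpBl hu hv.
by rewrite !pairingU; case: s => [|x s] /=; rewrite ?cmp0m ?cmpA.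
Qed.

Lemma pairing0 Z c : pairing (0 : hom Z (cch A n)) c = 0.
Proof.
by rewrite -[X in pairing X](cmpm0 Z (idm (cch A n))) -pairing_cmp cmpm0.
Qed.

End Pairing.

Lemma cmp_pairing A n J J' (f : hom J J') (th : forall x, hom (A x) J) Z
    (b : hom Z (cch A n)) c :
  f \oc pairing th b c = pairing (fun x => f \oc th x) b c.
Proof.
elim/free_ind: c => [|u v hu hv|s]; first by rewrite !raddf0 cmpm0.
  by rewrite !raddfB /= cmpBr hu hv.
by rewrite !pairingU; case: s => [|x s] /=; rewrite ?cmpm0 ?cmpA.
Qed.

Lemma eq_pairing A B n J (p : seq Q -> Prop) (th : forall x, hom (A x) J)
    (th' : forall x, hom (B x) J) Z (b : hom Z (cch A n)) (b' : hom Z (cch B n)) c :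
  (forall x s, p (x :: s) ->
    th x \oc prj A n x s \oc b = th' x \oc prj B n x s \oc b') ->
  supp p c -> pairing th b c = pairing th' b' c.
Proof. by move=> H; apply: eq_lin => -[|x s] // /H. Qed.

(** Restriction extended by 0 to all [y], as [pairing] requires a total family. *)
Definition res_to A x y : hom (A y) (A x) :=
  if boolP (y <= x)%O is AltTrue h then res A h else 0.

Lemma res_toE A x y (h : (y <= x)%O) : res_to A x y = res A h.
Proof.
rewrite /res_to; case: {-}_ / boolP => [h'|]; last by rewrite h.
by rewrite (Prop_irrelevance h' h).
Qed.

(** The simplicial coboundary: the identity, as universal cochain, is evaluated on the faces of
    [x :: s] with values carried to the stalk at the head. *)
Lemma delta_ex A n : exists u : hom (cch A n) (cch A n.+1),
  forall x s, valid n.+1 x s ->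
    prj A n.+1 x s \oc u = pairing (res_to A x) (idm _) (bds (x :: s)).
Proof. exact: cch_ex. Qed.

Definition delta A n : hom (cch A n) (cch A n.+1) := projT1 (cid (delta_ex A n)).

Lemma deltaE A n x s : valid n.+1 x s ->
  prj A n.+1 x s \oc delta A n = pairing (res_to A x) (idm _) (bds (x :: s)).
Proof. by move=> h; exact: (projT2 (cid (delta_ex A n))). Qed.

(** Compatibility is limited to restrictions into stalks over [D], because the projections of a
    coinduced sheaf to [J u] are compatible only below [u]. *)
Definition cocone A (D : Q -> Prop) J (th : forall x, hom (A x) J) : Prop :=
  forall x y (h : (y <= x)%O), D x -> th x \oc res A h = th y.

(** Stokes' formula: faces are restricted to the head [x], which lies in [D], and there [th] absorbs
    the restrictions. *)
Lemma pairing_delta A n (D : Q -> Prop) J (th : forall x, hom (A x) J) Z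
    (b : hom Z (cch A n)) c : cocone D th ->
  supp (fun s => dec n.+2 s /\ forall x, x \in s -> D x) c ->
  pairing th (delta A n \oc b) c = pairing th b (bd c).
Proof.
move=> thD; elim/supp_ind => [|u v hu hv|s [ds sD]]; first by rewrite !raddf0.
  by rewrite !raddfB /= hu hv.
rewrite pairingU bdU; case: s ds sD => [|x s] ds sD; first by rewrite raddf0.
rewrite /pairing_seq -cmpA (cmpA (prj _ _ _ _)) deltaE; last exact/validP.
rewrite pairing_cmp cmp1m cmp_pairing.
apply: eq_pairing (supp_bds_dec ds) => y t [_ ts].
have yx : (y <= x)%O by apply: (dec_head ds); apply: ts; exact: mem_head.
by rewrite (res_toE _ yx) thD //; apply: sD; exact: mem_head.
Qed.

Lemma res_to_cocone A x : cocone (fun y => (y <= x)%O) (res_to A x).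
Proof.
move=> y z zy yx; rewrite (res_toE _ yx) (res_toE _ (le_trans zy yx)); exact: resM.
Qed.

Lemma delta_delta A n : delta A n.+1 \oc delta A n = 0.
Proof.
apply: cch_eq => x s xs; rewrite cmpm0 cmpA deltaE // pairing_cmp cmp1m.
rewrite -[delta A n]cmpm1 (pairing_delta _ (@res_to_cocone A x)) ?bd_bds ?raddf0 //.
have ds : dec n.+3 (x :: s) by exact/validP.
apply: (suppW _ (@supp_bds_dec _ _ _ _ ds)) => t [dt ts]; split=> // y /ts.
exact: dec_head ds.
Qed.

Definition cch_complex A : cochain_complex V :=
  CochainComplex (@delta_delta A).

Section Functoriality.
Variable n : nat.

Lemma cmap_ex A B (f : hom A B) : exists u : hom (cch A n) (cch B n),
  forall x s, valid n x s -> prj B n x s \oc u = sapp f x \oc prj A n x s.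
Proof. exact: (@cch_ex B n _ (fun x s => sapp f x \oc prj A n x s)). Qed.

Definition cmap A B (f : hom A B) : hom (cch A n) (cch B n) :=
  projT1 (cid (cmap_ex f)).

Lemma cmapE A B (f : hom A B) x s :
  prj B n x s \oc cmap f = sapp f x \oc prj A n x s.
Proof.
have [h|h] := boolP (valid n x s); first exact: (projT2 (cid (cmap_ex f))).
by rewrite !prj_invalid // cmp0m cmpm0.
Qed.

Lemma cmapM A B C (g : hom B C) (f : hom A B) :
  cmap g \oc cmap f = cmap (g \oc f).
Proof.
by apply: cch_eq => x s _; rewrite cmpA !cmapE -cmpA cmapE cmpA.
Qed.

Lemma cmap0 A B : cmap (0 : hom A B) = 0.
Proof. by apply: cch_eq => x s _; rewrite cmapE cmpm0 cmp0m. Qed.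

Lemma cmap_mono A B (f : hom A B) : (forall x, mono (sapp f x)) -> mono (cmap f).
Proof.
move=> fm Z u v uv; apply: cch_eq => x s _; apply: fm.
by rewrite !cmpA -!cmapE -!cmpA uv.
Qed.

(** Local lifts of the finitely many components live on one common refinement by [fin_local], and
    there assemble into a cochain. *)
Lemma cmap_lift A B (f : hom A B) Z (z : hom Z (cch B n)) :
  (forall x s, valid n x s -> exists W (e : hom W Z) (w : hom W (A x)),
    epi e /\ sapp f x \oc w = prj B n x s \oc z \oc e) ->
  exists W (e : hom W Z) (w : hom W (cch A n)), epi e /\ cmap f \oc w = z \oc e.
Proof.
move=> loc.
pose good (i : Q * n.-tuple Q) W (e : hom W Z) := valid n i.1 i.2 ->
  exists w : hom W (A i.1), sapp f i.1 \oc w = prj B n i.1 i.2 \oc z \oc e.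
have [||W [e [ee eg]]] := @fin_local V _ Z good.
- move=> i W e W' e' ge /ge[w fw]; exists (w \oc e').
  by rewrite cmpA fw -!cmpA.
- move=> [x t]; have [h|h] := boolP (valid n x t); last first.
    exists Z, (idm Z); split; first exact: epi_idm.
    by rewrite /good /= (negPf h).
  have [W [e [w [ee fw]]]] := loc x t h.
  by exists W, e; split=> // _; exists w.
have wx x s : exists w : hom W (A x), valid n x s ->
    sapp f x \oc w = prj B n x s \oc z \oc e.
  have [h|h] := boolP (valid n x s); last by exists 0.
  have sn : size s == n by case/andP: h.
  by have [w fw] := eg (x, Tuple sn) h; exists w.
have [w wE] := @cch_ex A n W (fun x s => projT1 (cid (wx x s))).
exists W, e, w; split=> //; apply: cch_eq => x s h.
rewrite cmpA cmapE -cmpA wE // (projT2 (cid (wx x s))) //.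
by rewrite cmpA.
Qed.

Lemma cmap_kernel A B C (f : hom A B) (g : hom B C) :
  (forall x, is_kernel (sapp g x) (sapp f x)) -> is_kernel (cmap g) (cmap f).
Proof.
move=> gf; apply: kernelP.
- by apply: cmap_mono => x; exact: kernel_mono (gf x).
- rewrite cmapM -(cmap0 A C); congr cmap; apply: sheaf_homP => x; exact: (gf x).1.
move=> T t gt; apply: cmap_lift => x s _.
have gxt : sapp g x \oc (prj B n x s \oc t) = 0.
  by rewrite cmpA -cmapE -cmpA gt cmpm0.
have [w [fw _]] := (gf x).2 _ _ gxt.
by exists T, (idm T), w; split; [exact: epi_idm | rewrite cmpm1].
Qed.

End Functoriality.

Lemma cmap_delta A B (f : hom A B) n :
  delta B n \oc cmap n f = cmap n.+1 f \oc delta A n.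
Proof.
apply: cch_eq => x s xs; have ds : dec n.+2 (x :: s) by exact/validP.
rewrite cmpA deltaE // pairing_cmp cmp1m [RHS]cmpA cmapE -cmpA deltaE // cmp_pairing.
apply: eq_pairing (supp_bds_dec ds) => y t [_ ts].
have yx : (y <= x)%O by apply: (dec_head ds); apply: ts; exact: mem_head.
by rewrite !(res_toE _ yx) -cmpA cmapE !cmpA cmpm1 sappE.
Qed.

(** Cocycles of positive degree bound without epimorphic refinement; the explicit contractions below
    give exactness in this strong form. *)
Definition acyclic A : Prop := forall k Z (b : hom Z (cch A k.+1)),
  delta A k.+1 \oc b = 0 -> exists b' : hom Z (cch A k), delta A k \oc b' = b.

Lemma acyclic_retract A B (i : hom A B) (r : hom B A) : r \oc i = idm A ->
  acyclic B -> acyclic A.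
Proof.
move=> ri aB k Z b db.
have ric m : cmap m r \oc cmap m i = idm _.
  rewrite cmapM ri; apply: cch_eq => x s _.
  by rewrite cmapE cmpm1; exact: cmp1m.
have [|b' b'E] := aB k Z (cmap k.+1 i \oc b).
  by rewrite cmpA cmap_delta -cmpA db cmpm0.
exists (cmap k r \oc b').
by rewrite cmpA cmap_delta -cmpA b'E cmpA ric cmp1m.
Qed.

End Cochains.

(** * Acyclic resolutions *)

Section Resolution.
Context {d : Order.disp_t} {Q : finPOrderType d} {V : abelianCat}.
Local Notation Sh := (sheaf_preadditive Q V).
Implicit Types (F A B G : Sh).

(** * Dimension shifting along a short exact sequence *)

Section ShortExact.
Variables (F B G : Sh) (eta : hom F B) (p : hom B G).
Hypothesis etaK : forall x, is_kernel (sapp p x) (sapp eta x).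
Hypothesis pE : forall x, epi (sapp p x).
Hypothesis aB : acyclic B.

Let mono_eta n : mono (cmap n eta) := kernel_mono (cmap_kernel n etaK).

Let lift_p n T (t : hom T (cch G n)) :
  exists W (e : hom W T) (w : hom W (cch B n)), epi e /\ cmap n p \oc w = t \oc e.
Proof.
apply: cmap_lift => x s _.
have [W [e [w [ee pw]]]] := epi_pullback (prj G n x s \oc t) (@pE x).
by exists W, e, w.
Qed.

(** Cochains of [B] that become cocycles in [G]. This is the apex of the span: [cmap n p] leads to
    the cocycles of [G], the connecting map to those of [F]. *)
Let cocycle n := ker (delta G n \oc cmap n p).
Let cz n : hom (cocycle n) (cch B n) := kerm (delta G n \oc cmap n p).

Let cz_lift n T (t : hom T (cch B n)) : delta G n \oc (cmap n p \oc t) = 0 ->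
  exists w, cz n \oc w = t.
Proof. by rewrite cmpA => /ker_lift_ex. Qed.

Lemma connecting_ex n : exists w : hom (cocycle n) (cch F n.+1),
  cmap n.+1 eta \oc w = delta B n \oc cz n /\ delta F n.+1 \oc w = 0.
Proof.
have [|w [ew _]] := (cmap_kernel n.+1 etaK).2 _ (delta B n \oc cz n).
  by rewrite cmpA -cmap_delta (kermP _).1.
exists w; split=> //; apply: mono_eta.
by rewrite cmpA -cmap_delta -cmpA ew cmpA delta_delta cmp0m cmpm0.
Qed.

Definition connecting n := projT1 (cid (connecting_ex n)).
Lemma connectingE n :
  cmap n.+1 eta \oc connecting n = delta B n \oc cz n.
Proof. exact: (projT2 (cid (connecting_ex n))).1. Qed.
Lemma delta_connecting n : delta F n.+1 \oc connecting n = 0.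
Proof. exact: (projT2 (cid (connecting_ex n))).2. Qed.

(** As [B] is acyclic, a cocycle of [F] becomes the coboundary of some [b] in [B], and [b] maps to a
    cocycle of [G]. *)
Lemma connecting_onto n T (y : hom T (cch F n.+1)) : delta F n.+1 \oc y = 0 ->
  exists U (e : hom U T) (t : hom U (cocycle n)),
    epi e /\ connecting n \oc t = y \oc e.
Proof.
move=> dy; have [|b db] := aB (b := cmap n.+1 eta \oc y).
  by rewrite cmpA cmap_delta -cmpA dy cmpm0.
have [|t tb] := @cz_lift n _ b.
  by rewrite cmpA cmap_delta -cmpA db cmpA (cmap_kernel _ etaK).1 cmp0m.
exists T, (idm T), t; split; first exact: epi_idm.
by apply: mono_eta; rewrite cmpm1 cmpA connectingE -cmpA tb.
Qed.

Lemma connecting_bounds n T (t : hom T (cocycle n)) (x : hom T (cch F n)) :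
  delta F n \oc x = connecting n \oc t <->
  delta B n \oc (cz n \oc t - cmap n eta \oc x) = 0.
Proof.
rewrite cmpBr !cmpA -connectingE cmap_delta -!cmpA -cmpBr; split=> [->|H].
  by rewrite subrr cmpm0.
apply/esym/eqP; rewrite -subr_eq0; apply/eqP.
by move/mono0P: (@mono_eta n.+1); apply.
Qed.

(** The connecting isomorphism of the long exact sequence. Acyclicity of [B] in degree [n.+2] makes
    the span reach all cocycles of [F]; in degree [n.+1] it makes bounding in [F] imply bounding in
    [G]. *)
Lemma connecting_isomorphic n :
  isomorphic (cohomology (cch_complex G) n.+1) (cohomology (cch_complex F) n.+2).
Proof.
apply: (@span_isomorphic V _ _ _ _ _ _ _ _ _ _ _ _ _
  (cmap n.+1 p \oc cz n.+1) (connecting n.+1)).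
- by rewrite /= cmpA (kermP _).1.
- exact: delta_connecting.
- move=> T y dy; have [W [e [b [ee pb]]]] := lift_p y.
  have [|t tb] := @cz_lift n.+1 _ b; first by rewrite pb cmpA dy cmp0m.
  by exists W, e, t; split=> //; rewrite -cmpA tb.
- exact: connecting_onto.
- move=> T t x /= dx; have [W [e [b0 [ee pb0]]]] := lift_p x.
  have [|a [ea _]] := (cmap_kernel n.+1 etaK).2 _
      (cz n.+1 \oc (t \oc e) - delta B n \oc b0).
    by rewrite cmpBr !cmpA -dx -cmap_delta -!cmpA pb0 subrr.
  exists W, e, a; split=> //; rewrite -cmpA; apply/connecting_bounds.
  by rewrite ea opprB addrC subrK cmpA delta_delta cmp0m.
move=> T t x /= /connecting_bounds/aB[b db].
exists T, (idm T), (cmap n p \oc b); split; first exact: epi_idm.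
rewrite cmpm1 cmpA cmap_delta -cmpA db cmpBr !cmpA (cmap_kernel _ etaK).1 cmp0m.
by rewrite subr0.
Qed.

Section DegreeOne.
Variables (A : Sh) (io : hom G A) (X0 X1 X2 : V).
Hypothesis ioM : forall x, mono (sapp io x).
Variables (x0 : hom X0 (cch B 0)) (x1 : hom X1 (cch A 0)).
Variables (d0 : hom X0 X1) (d1 : hom X1 X2).
Hypothesis x0K : is_kernel (delta B 0) x0.
Hypothesis x1K : is_kernel (delta A 0) x1.
Hypothesis d01 : d1 \oc d0 = 0.
Hypothesis xd0 : x1 \oc d0 = cmap 0 (io \oc p) \oc x0.
Hypothesis d1K : forall T (y : hom T X1),
  d1 \oc y = 0 <-> exists g, x1 \oc y = cmap 0 io \oc g.

(** In degree 0 cocycles of [B] do not bound; instead [x0K] identifies them with [X0]. By [d1K] the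
    cocycles in [X1] are those with values in [G], so the quotient by [X0] is again reached by the
    connecting map. *)
Lemma degree_one_isomorphic :
  isomorphic (coker (ker_lift d01)) (cohomology (cch_complex F) 1).
Proof.
have mio n : mono (cmap n io) by exact: cmap_mono.
have [|w [ew _]] := x1K.2 _ (cmap 0 io \oc (cmap 0 p \oc cz 0)).
  by rewrite (cmpA (delta A 0)) cmap_delta -cmpA (cmpA (delta _ _)) (kermP _).1 cmpm0.
apply: (@span_isomorphic V _ _ _ _ _ _ _ _ _ _ _ _ _ (w) (connecting 0)).
- by apply/d1K; exists (cmap 0 p \oc cz 0).
- exact: delta_connecting.
- move=> T y /d1K[g yg]; have [W [e [b [ee pb]]]] := lift_p g.
  have dg : delta G 0 \oc g = 0.
    apply: (mio 1%N).
    by rewrite cmpA -cmap_delta -cmpA -yg cmpA x1K.1 cmp0m cmpm0.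
  have [|t tb] := @cz_lift 0 _ b; first by rewrite pb cmpA dg cmp0m.
  exists W, e, t; split=> //; apply: (kernel_mono x1K).
  by rewrite !cmpA ew yg -!cmpA tb pb.
- exact: connecting_onto.
- move=> T t x dx.
  have [|a [ea _]] := (cmap_kernel 0 etaK).2 _ (cz 0 \oc t - x0 \oc x).
    have e1 : cmap 0 io \oc (cmap 0 p \oc (x0 \oc x)) = x1 \oc (w \oc t).
      rewrite !(cmpA (cmap 0 io)) cmapM (cmpA (cmap 0 (io \oc p))) -xd0.
      by rewrite -(cmpA x1 d0 x) dx.
    have e2 : cmap 0 io \oc (cmap 0 p \oc (cz 0 \oc t)) = x1 \oc (w \oc t).
      by rewrite (cmpA x1) ew !cmpA.
    by apply: (mio 0%N); rewrite cmpm0 !cmpBr e1 e2 subrr.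
  exists T, (idm T), a; split; first exact: epi_idm.
  rewrite cmpm1; apply/connecting_bounds.
  by rewrite ea opprB addrC subrK cmpA x0K.1 cmp0m.
move=> T t a /= /connecting_bounds/(x0K.2)[x [xE _]].
exists T, (idm T), x; split; first exact: epi_idm.
apply: (kernel_mono x1K); rewrite cmpm1 cmpA xd0 -cmpA xE cmpBr -cmapM.
have -> : cmap 0 io \oc cmap 0 p \oc (cmap 0 eta \oc a) = 0.
  by rewrite -cmpA (cmpA (cmap 0 p)) (cmap_kernel 0 etaK).1 cmp0m cmpm0.
by rewrite subr0 (cmpA x1) ew !cmpA.
Qed.

End DegreeOne.
End ShortExact.

Record acyclic_resolution F := AcyclicResolution {
  ar_obj : nat -> Sh;
  ar_diff : forall n, hom (ar_obj n) (ar_obj n.+1);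
  ar_aug : hom F (ar_obj 0);
  ar_acyclic : forall n, acyclic (ar_obj n);
  ar_kernel : forall x, is_kernel (sapp (ar_diff 0) x) (sapp ar_aug x);
  ar_diffK : forall n, ar_diff n.+1 \oc ar_diff n = 0;
  ar_exact : forall n x Z (z : hom Z (ar_obj n.+1 x)),
    sapp (ar_diff n.+1) x \oc z = 0 ->
    exists W (e : hom W Z) (w : hom W (ar_obj n x)),
      epi e /\ sapp (ar_diff n) x \oc w = z \oc e
}.

Arguments ar_obj {F} a n.
Arguments ar_diff {F} a n.

(** An abstract complex identified with the degree 0 cocycles of the resolution; this allows
    sections over one poset to be compared with cochains on another. *)
Record sections_complex F (A : acyclic_resolution F) := SectionsComplex {
  sc_complex : cochain_complex V;
  sc_map : forall n, hom (sc_complex n) (cch (ar_obj A n) 0);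
  sc_kernel : forall n, is_kernel (delta (ar_obj A n) 0) (sc_map n);
  sc_diff : forall n,
    sc_map n.+1 \oc cdiff sc_complex n = cmap 0 (ar_diff A n) \oc sc_map n
}.

Arguments sc_map {F A} s n.

(** Degree 0 compares two kernels inside the cochains of the first term, degree 1 is
    [degree_one_isomorphic], and in higher degrees the truncated resolution of [G] lowers the degree
    by one. *)
Theorem acyclic_resolution_cohomology F (A : acyclic_resolution F)
    (X : sections_complex A) n :
  isomorphic (cohomology (sc_complex X) n) (cohomology (cch_complex F) n).
Proof.
elim: n F A X => [|n IH] F A X.
  pose m := sc_map X 0 \oc kerm (cdiff (sc_complex X) 0).
  have mm : mono m.
    move=> Z u v; rewrite -!cmpA => /(kernel_mono (sc_kernel X 0)).
    exact: (kernel_mono (kermP _)).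
  have mm' : mono (cmap 0 (ar_aug A) \oc kerm (delta F 0)).
    move=> Z u v; rewrite -!cmpA => /(kernel_mono (cmap_kernel 0 (ar_kernel A))).
    exact: (kernel_mono (kermP _)).
  apply: (mono_isomorphic mm mm') => /=.
    have [|u [uE _]] := (cmap_kernel 0 (ar_kernel A)).2 _ m.
      by rewrite cmpA -sc_diff -cmpA (kermP _).1 cmpm0.
    have [|v vE] := @ker_lift_ex _ _ _ _ (delta F 0) u.
      apply: (kernel_mono (cmap_kernel 1 (ar_kernel A))).
      by rewrite cmpA -cmap_delta -cmpA uE cmpm0 cmpA (sc_kernel X 0).1 cmp0m.
    by exists v; rewrite -cmpA vE.
  have [|u [uE _]] := (sc_kernel X 0).2 _ (cmap 0 (ar_aug A) \oc kerm (delta F 0)).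
    by rewrite cmpA cmap_delta -cmpA (kermP _).1 cmpm0.
  have [|v vE] := @ker_lift_ex _ _ _ _ (cdiff (sc_complex X) 0) u.
    apply: (kernel_mono (sc_kernel X 1)).
    by rewrite cmpA sc_diff -cmpA uE cmpm0 cmpA (cmap_kernel 0 (ar_kernel A)).1 cmp0m.
  by exists v; rewrite /m -cmpA vE.
(* [G] is the kernel of the second differential; by exactness it is the quotient of the first term
   by [F], and the remaining terms resolve it. *)
pose d1 := ar_diff A 1; pose G : Sh := sker d1.
pose io : hom G (ar_obj A 1) := skerm d1.
have ioK x : is_kernel (sapp d1 x) (sapp io x) by exact: kermP.
have ioM x : mono (sapp io x) by exact: kernel_mono (ioK x).
have [p [pE _]] := (skermP d1).2 _ _ (ar_diffK A 0).
have etaK x : is_kernel (sapp p x) (sapp (ar_aug A) x).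
  split=> [|Z z pz].
    apply: ioM; rewrite cmpm0 cmpA (shomE x pE : sapp io x \oc sapp p x = _).
    exact: (ar_kernel A x).1.
  apply: (ar_kernel A x).2.
  by rewrite -(shomE x pE : sapp io x \oc sapp p x = _) -cmpA pz cmpm0.
have pEpi x : epi (sapp p x).
  have [W [e [w [ee dw]]]] := ar_exact (ioK x).1.
  apply: (epi_of_local (w := w) ee); apply: ioM.
  by rewrite cmpA (shomE x pE : sapp io x \oc sapp p x = _).
have aA : acyclic (ar_obj A 0) by exact: ar_acyclic.
case: n IH => [|n] IH.
  apply: (@degree_one_isomorphic F (ar_obj A 0) G (ar_aug A) p etaK pEpi aA
    (ar_obj A 1) io _ _ _ ioM _ _ _ _ (sc_kernel X 0) (sc_kernel X 1)
    (cdiffK (sc_complex X) 0)).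
    by rewrite sc_diff pE.
  move=> T y; split=> [dy|[g yg]].
    have [|g [gE _]] := (cmap_kernel 0 ioK).2 _ (sc_map X 1 \oc y).
      by rewrite cmpA -sc_diff -cmpA dy cmpm0.
    by exists g.
  apply: (kernel_mono (sc_kernel X 2)).
  by rewrite cmpA sc_diff -cmpA yg cmpm0 cmpA (cmap_kernel 0 ioK).1 cmp0m.
pose A' := @AcyclicResolution G (fun n => ar_obj A n.+1) (fun n => ar_diff A n.+1)
  io (fun n => @ar_acyclic _ A n.+1) ioK (fun n => ar_diffK A n.+1)
  (fun n => @ar_exact _ A n.+1).
pose X' := @SectionsComplex G A' (@CochainComplex V
    (fun n => sc_complex X n.+1) (fun n => cdiff (sc_complex X) n.+1)
    (fun n => cdiffK (sc_complex X) n.+1))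
  (fun n => sc_map X n.+1) (fun n => sc_kernel X n.+1) (fun n => sc_diff X n.+1).
apply: isomorphic_trans (IH G A' X') _.
exact: (connecting_isomorphic etaK pEpi aA n).
Qed.

End Resolution.

(** * Contractions of order complexes *)

Section Contraction.
Context {d : Order.disp_t} {Q : finPOrderType d}.
Local Notation L := {free (seq Q)}.
Variable D : Q -> Prop.

Definition decin n (s : seq Q) : Prop := dec n s /\ forall x, x \in s -> D x.

(* The order complex of the subset D has vanishing reduced homology. *)
Definition bounding : Prop := forall n (z : L), supp (decin n) z -> bd z = 0 ->
  exists2 w, supp (decin n.+1) w & bd w = z.

Lemma supp_bds_decin n s : decin n.+1 s -> supp (decin n) (bds s).
Proof.
move=> [ds sD]; apply: (suppW _ (@supp_bds_dec _ _ n s ds)) => t [dt ts].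
by split=> // x /ts; exact: sD.
Qed.

Definition fillin n (z : L) : L :=
  if pselect (exists w, supp (decin n.+1) w /\ bd w = z) is left e
  then projT1 (cid e) else 0.

(** The value on [s] is a chosen filling of [s] minus the contraction of its boundary, a cycle by
    the equation in the previous degree. *)
Fixpoint contrs n (s : seq Q) : L :=
  fillin n (<[s]> - (if n is m.+1 then lin (contrs m) (bds s) else 0)).

Lemma contrsP : bounding -> forall n s, decin n s ->
  supp (decin n.+1) (contrs n s) /\
  bd (contrs n s) = <[s]> - lin (contrs n.-1) (bds s).
Proof.
move=> bD; have fillP n z : supp (decin n) z -> bd z = 0 ->
    supp (decin n.+1) (fillin n z) /\ bd (fillin n z) = z.
  move=> zn bz; rewrite /fillin; case: pselect => [e|[]].
    exact: projT2 (cid e).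
  by have [w wn bw] := bD n z zn bz; exists w.
elim=> [|n IH] s ds.
  have s0 : s = [::] by apply: size0nil; case: ds => -[].
  have b0 : bds s = 0 by rewrite s0.
  rewrite /= b0 !raddf0 !addr0; apply: fillP; first exact: suppU.
  by rewrite bdU.
apply: fillP; last first.
  have H z : supp (decin n) z ->
      bd (lin (contrs n) z) = z - lin (contrs n.-1) (bd z).
    elim/supp_ind => [|u v hu hv|t /IH[_]]; last by rewrite linU bdU.
      by rewrite !raddf0 addr0.
    rewrite (raddfB (lin (contrs n))) !(raddfB bd) (raddfB (lin _)) /= hu hv.
    by rewrite !opprD !opprK addrACA.
  rewrite raddfB /= H; last exact: supp_bds_decin.
  by rewrite bdU bd_bds raddf0 subr0 subrr.
apply: suppB; first exact: suppU.
by apply: supp_lin (@supp_bds_decin n s ds) => t /IH[].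
Qed.

Lemma contraction_ex : bounding -> exists h : seq Q -> L, forall n s,
  decin n s -> supp (decin n.+1) (h s) /\ bd (h s) = <[s]> - lin h (bds s).
Proof.
move=> bD; exists (fun s => contrs (size s) s) => n s ds.
have sn : size s = n by case: ds => -[].
have [h1 h2] := contrsP bD ds; rewrite sn; split=> //; rewrite h2.
congr (_ - _); case: n ds sn {h1 h2} => [|n] ds sn.
  by rewrite (size0nil sn) /bds !raddf0.
by apply: eq_lin (@supp_bds_decin n s ds) => t [[_ ->]].
Qed.

End Contraction.

Lemma bounding_top (d : Order.disp_t) (Q : finPOrderType d) (u : Q) :
  bounding (fun x => (x <= u)%O).
Proof.
move=> n z zn bz; exists (cone u z); last by rewrite bd_cone bz raddf0 subr0.
apply: supp_cone zn => s [ds su]; split; first exact: dec_cons.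
by move=> x; rewrite inE => /predU1P[->//|/su].
Qed.

(** The elements of the complement of [s] that lie below [s] are those of the strict lower set, so a
    cycle is filled there by [point_acyclic] and the filling is carried back. *)
Lemma bounding_below (R : realType) (d : Order.disp_t) (S : finPOrderType d)
    (s : S) :
  has_homology_of_point R
    (poset_realization R (subposet [set v : S | (v < s)%O]%SET)) ->
  bounding (fun x : subposet [set~ s]%SET => (val x <= s)%O).
Proof.
set P := subposet [set v : S | (v < s)%O]%SET; set Q := subposet [set~ s]%SET.
move=> hs; have [[p0 _] _] := point_H0 hs.
have jP (x : P) : val x \in [set~ s]%SET.
  by case: x => x /=; rewrite !inE => /lt_eqF ->.
pose j (x : P) : Q := Subposet (jP x).
(* The default [p0] is taken only at elements not below [s], which do not occur in [z]. *)
pose k (x : Q) : P := insubd p0 (val x).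
have kE (x : Q) : (val x <= s)%O -> val (k x) = val x.
  move=> xs; rewrite /k val_insubd inE lt_neqAle xs andbT.
  by case: x xs => x /=; rewrite !inE => ->.
have jk (x : Q) : (val x <= s)%O -> j (k x) = x.
  by move=> xs; apply: val_inj; exact: kE.
move=> n z zn bz.
have [||w wn bw] := point_acyclic hs (n := n) (z := mapc k z) _ _.
- apply: supp_mapc zn => t [[st tn] ts]; split; last by rewrite size_map.
  rewrite sorted_map; apply: (sub_in_sorted (P := [in t]) _ _ st); last exact/allP.
  move=> x y /ts xs /ts ys yx.
  suff : (val (k y) <= val (k x))%O by [].
  by rewrite !kE.
- by rewrite bd_mapc bz raddf0.
exists (mapc j w).
  apply: supp_mapc wn => t [st tn]; split.
    split; last by rewrite size_map.
    by rewrite sorted_map; apply: sub_sorted st => x y.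
  move=> _ /mapP[x _ ->]; case: x => x /=; rewrite inE; exact: ltW.
rewrite bd_mapc bw mapc_comp -[RHS](lin_additive idfun).
apply: eq_lin zn => t [_ ts]; congr << _ >>.
by rewrite -[RHS]map_id; apply/eq_in_map => x /ts; exact: jk.
Qed.

(** * Coinduced sheaves *)

Section Pullback.
Context {d d' : Order.disp_t} {S : finPOrderType d} {Q : finPOrderType d'}.
Context {V : abelianCat}.
Variables (j : Q -> S) (jh : forall x y, (x <= y)%O -> (j x <= j y)%O).
Local Notation ShS := (sheaf_preadditive S V).
Local Notation ShQ := (sheaf_preadditive Q V).

Definition pullback (F : ShS) : ShQ :=
  @Sheaf _ Q V (fun x => F (j x)) (fun x y h => res F (jh h))
    (fun x h => res1 F (jh h)) (fun x y z h k l => resM F (jh h) (jh k) (jh l)).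

Definition pullback_map (F G : ShS) (f : hom F G) :
    hom (pullback F) (pullback G) :=
  @SheafHom _ Q V (pullback F) (pullback G) (fun x => sapp f (j x))
    (fun x y h => sappE f (jh h)).

Lemma sections_cochain_ex (F : ShS) :
  exists u : hom (sections F) (cch (pullback F) 0),
    forall x s, valid 0 x s ->
      prj (pullback F) 0 x s \oc u = section_at F (j x).
Proof. exact: (@cch_ex _ _ _ (pullback F) 0 _ (fun x s => section_at F (j x))). Qed.

Definition sections_cochain (F : ShS) : hom (sections F) (cch (pullback F) 0) :=
  projT1 (cid (sections_cochain_ex F)).

Lemma sections_cochainE (F : ShS) x s : valid 0 x s ->
  prj (pullback F) 0 x s \oc sections_cochain F = section_at F (j x).
Proof. by move=> h; exact: (projT2 (cid (sections_cochain_ex F))). Qed.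

Lemma sections_cochain_map (F G : ShS) (f : hom F G) :
  sections_cochain G \oc sections_map f =
  cmap 0 (pullback_map f) \oc sections_cochain F.
Proof.
apply: cch_eq => x s xs; rewrite !cmpA sections_cochainE // sections_mapE.
by rewrite cmapE -cmpA sections_cochainE.
Qed.

Lemma delta_sections_cochain (F : ShS) :
  delta (pullback F) 0 \oc sections_cochain F = 0.
Proof.
apply: cch_eq => x s xs; rewrite cmpA deltaE // pairing_cmp cmp1m cmpm0.
case: s xs => [|y [|? ?]]; rewrite /valid /= ?andbF // => /andP[/andP[yx _] _].
have v0 z : valid 0 z [::] by [].
rewrite /bds /= raddfB raddf0 subr0 /= -/(cone _) coneU !pairingU /=.
rewrite -!cmpA !sections_cochainE // (res_toE _ yx) (res_toE _ (lexx x)).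
rewrite (res1 (pullback F)) cmp1m.
by apply/eqP; rewrite subr_eq0; apply/eqP; exact: (sectionsP F).1.
Qed.

Section Coinduced.
Variable J : S -> V.

Lemma up_product_ex t : exists C : {C : V & forall u : S, hom C (J u)},
  (forall Z (q : forall u, hom Z (J u)), exists w : hom Z (projT1 C),
     forall u, (t <= u)%O -> projT2 C u \oc w = q u) /\
  (forall Z (v w : hom Z (projT1 C)),
     (forall u, (t <= u)%O -> projT2 C u \oc v = projT2 C u \oc w) -> v = w).
Proof.
pose I := {u : S | (t <= u)%O}.
have [P [p pP]] := fin_product (fun i : I => J (val i)).
pose pr u : hom P (J u) :=
  if boolP (t <= u)%O is AltTrue h then p (exist _ u h) else 0.
have prE u (h : (t <= u)%O) : pr u = p (exist _ u h).
  rewrite /pr; case: {-}_ / boolP => [h'|]; last by rewrite h.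
  by rewrite (Prop_irrelevance h' h).
exists (existT _ P pr); split=> [Z q|Z v w vw] /=.
  have [w [wq _]] := pP Z (fun i : I => q (val i)).
  by exists w => u h; rewrite prE; exact: (wq (exist _ u h)).
have [m [_ mP]] := pP Z (fun i => p i \oc w).
by rewrite -(mP w) // -(mP v) // => -[u h]; rewrite -prE vw.
Qed.

Let P t : V := projT1 (projT1 (cid (up_product_ex t))).
Let pr t u : hom (P t) (J u) := projT2 (projT1 (cid (up_product_ex t))) u.

Let pr_ex t Z (q : forall u, hom Z (J u)) : exists w : hom Z (P t),
  forall u, (t <= u)%O -> pr t u \oc w = q u.
Proof. exact: (projT2 (cid (up_product_ex t))).1. Qed.

Let pr_eq t Z (v w : hom Z (P t)) :
  (forall u, (t <= u)%O -> pr t u \oc v = pr t u \oc w) -> v = w.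
Proof. exact: (projT2 (cid (up_product_ex t))).2. Qed.

Let r s t (h : (s <= t)%O) : hom (P s) (P t) := projT1 (cid (pr_ex t (pr s))).

Let rE s t (h : (s <= t)%O) u : (t <= u)%O -> pr t u \oc r h = pr s u.
Proof. exact: (projT2 (cid (pr_ex t (pr s)))). Qed.

(* t |-> prod_(u >= t) J u, the product of the extensions by zero of the
   constant sheaves J u on the closures of the points u. *)
Definition coind : ShS.
Proof.
refine (@Sheaf _ S V P r _ _).
- by move=> s h; apply: pr_eq => u su; rewrite rE // cmpm1.
- move=> s t u h k l; apply: pr_eq => w uw.
  by rewrite cmpA !rE // (le_trans k).
Defined.

Definition coind_pr (t u : S) : hom (coind t) (J u) := pr t u.

Lemma coind_ex t Z (q : forall u, hom Z (J u)) : exists w : hom Z (coind t),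
  forall u, (t <= u)%O -> coind_pr t u \oc w = q u.
Proof. exact: pr_ex. Qed.

Lemma coind_eq t Z (v w : hom Z (coind t)) :
  (forall u, (t <= u)%O -> coind_pr t u \oc v = coind_pr t u \oc w) -> v = w.
Proof. exact: pr_eq. Qed.

Lemma coind_res s t (h : (s <= t)%O) u : (t <= u)%O ->
  coind_pr t u \oc res coind h = coind_pr s u.
Proof. exact: rE. Qed.

(** Existence half of the adjunction: a family of maps from the stalks to the [J u] comes from a map
    into the coinduced sheaf. *)
Lemma coind_hom_ex (F : ShS) (f : forall u, hom (F u) (J u)) :
  exists g : hom F coind, forall u, coind_pr u u \oc sapp g u = f u.
Proof.
have ft t := coind_ex t (fun u => f u \oc res_to F u t).
pose g t : hom (F t) (coind t) := projT1 (cid (ft t)).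
have gE t u (h : (t <= u)%O) : coind_pr t u \oc g t = f u \oc res F h.
  by rewrite (projT2 (cid (ft t))) // (res_toE _ h).
have gn s t (h : (s <= t)%O) : g t \oc res F h = res coind h \oc g s.
  apply: coind_eq => u tu; rewrite !cmpA (gE _ _ tu) coind_res //.
  by rewrite (gE _ _ (le_trans h tu)) -cmpA (resM F h tu (le_trans h tu)).
by exists (SheafHom gn) => u /=; rewrite (gE _ _ (lexx u)) res1 cmpm1.
Qed.

Hypothesis bj : forall u, bounding (fun x => (j x <= u)%O).
Local Notation G := (pullback coind).
Let th u x : hom (G x) (J u) := coind_pr (j x) u.

Let thC u : cocone (A := G) (fun x => (j x <= u)%O) (th u).
Proof. by move=> x y h xu; exact: coind_res. Qed.

(** The components in [J u] involve only sequences over [D = {x | j x <= u}], whose chains have a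
    contraction [h u]. Its transpose [b' = b o h u] satisfies [delta b' = b] by Stokes' formula,
    since the remaining term evaluates [delta b = 0]. *)
Lemma pullback_coind_acyclic : acyclic G.
Proof.
move=> k Z b db.
have hu u := cid (contraction_ex (@bj u)).
pose h u := projT1 (hu u).
have hP u n s (ds : decin (fun x => (j x <= u)%O) n s) :
    supp (decin (fun x => (j x <= u)%O) n.+1) (h u s) /\
    bd (h u s) = <[s]> - lin (h u) (bds s) := projT2 (hu u) n s ds.
have qx x s := cid (coind_ex (j x) (fun u => pairing (th u) b (h u (x :: s)))).
have [b' b'E] := @cch_ex _ _ _ G k Z (fun x s => projT1 (qx x s)).
have b'h u y : supp (decin (fun x => (j x <= u)%O) k.+1) y ->
    pairing (th u) b' y = pairing (th u) b (lin (h u) y).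
  move=> yk; rewrite /pairing lin_comp.
  apply: eq_lin yk => -[|x s] [ds su]; first by case: ds.
  rewrite /= -cmpA b'E; last exact/validP.
  by rewrite (projT2 (qx x s)) // su // mem_head.
exists b'; apply: cch_eq => x s xs; apply: coind_eq => u xu.
have ds : decin (fun x => (j x <= u)%O) k.+2 (x :: s).
  have ds : dec k.+2 (x :: s) by exact/validP.
  split=> // y /(dec_head ds) yx; exact: le_trans (jh yx) xu.
rewrite !(cmpA (coind_pr (j x) u)).
have E (c : hom Z (cch G k.+1)) :
    coind_pr (j x) u \oc prj G k.+1 x s \oc c = pairing (th u) c <[x :: s]>.
  by rewrite pairingU.
rewrite !E (pairing_delta _ (@thC u)); last exact: suppU.
have [sh bh] := hP u _ _ ds.
rewrite bdU b'h; last exact: supp_bds_decin.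
have -> : lin (h u) (bds (x :: s)) = <[x :: s]> - bd (h u (x :: s)).
  by rewrite bh opprB addrC subrK.
rewrite raddfB /= -[X in _ - X](pairing_delta _ (@thC u)) //.
by rewrite db pairing0 subr0.
Qed.

Lemma coind_section t u (h : (t <= u)%O) Z (v : hom Z (sections coind)) :
  coind_pr t u \oc (section_at coind t \oc v) =
  coind_pr u u \oc (section_at coind u \oc v).
Proof.
by rewrite -((sectionsP coind).1 t u h) -(coind_res h (lexx u)) !cmpA.
Qed.

(** A section of the coinduced sheaf amounts to one component in each [J u]. A 0-cocycle [b]
    determines it as the value of [b] on a 0-chain [c u] of augmentation 1 below [u], namely a
    filling of the empty sequence. *)
Lemma sections_cochain_coind : is_kernel (delta G 0) (sections_cochain coind).
Proof.
have base_ex u : exists c, supp (decin (fun x => (j x <= u)%O) 1) c /\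
    bd c = <[[::]]>.
  have [||c c1 bc] := @bj u 0 <[[::]]>; last by exists c.
    exact: suppU.
  by rewrite bdU.
pose c u := projT1 (cid (base_ex u)).
have c1 u : supp (decin (fun x => (j x <= u)%O) 1) (c u).
  exact: (projT2 (cid (base_ex u))).1.
have bc u : bd (c u) = <[[::]]> := (projT2 (cid (base_ex u))).2.
have eps1 u : lin (fun=> 1 : int) (c u) = 1.
  rewrite -lin1_bd ?bc ?linU //.
  by apply: (suppW _ (c1 u)) => s [].
have key u Z (v : hom Z (sections coind)) :
    coind_pr u u \oc (section_at coind u \oc v) =
    pairing (th u) (sections_cochain coind \oc v) (c u).
  suff H y : supp (decin (fun x => (j x <= u)%O) 1) y ->
      pairing (th u) (sections_cochain coind \oc v) y =
      (coind_pr u u \oc (section_at coind u \oc v)) *~ lin (fun=> 1) y.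
    by rewrite H // eps1.
  elim/supp_ind => [|y1 y2 h1 h2|s [ds su]]; first by rewrite !raddf0.
    by rewrite !raddfB /= h1 h2.
  rewrite pairingU linU mulr1z; case: s ds su => [|x [|? ?]] [_ //] _ su.
  rewrite /= -cmpA (cmpA (prj _ _ _ _)) sections_cochainE //.
  by apply: coind_section; apply: su; exact: mem_head.
split=> [|Z b db]; first exact: delta_sections_cochain.
have st t := cid (coind_ex t (fun u => pairing (th u) b (c u))).
have stE t u : (t <= u)%O -> coind_pr t u \oc projT1 (st t) = pairing (th u) b (c u).
  exact: (projT2 (st t)).
have [|g [gE _]] := (sectionsP coind).2 Z (fun t => projT1 (st t)).
  move=> s t h; apply: coind_eq => u tu.
  by rewrite cmpA coind_res // !stE // (le_trans h).
exists g; split=> [|g' g'b].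
  apply: cch_eq => x s xs; rewrite cmpA sections_cochainE // gE.
  apply: coind_eq => u xu; rewrite stE //.
  have s0 : s = [::] by apply: size0nil; case/andP: xs => _ /eqP.
  have x1 : decin (fun x => (j x <= u)%O) 1 [:: x].
    by split=> // y; rewrite mem_seq1 => /eqP ->.
  (* A vertex and [c u] have the same boundary, so they differ by a boundary, on which the cocycle
     [b] vanishes. *)
  have [||w w2 bw] := @bj u 1 (c u - <[[:: x]]>).
  - by apply: suppB => //; exact: suppU.
  - by rewrite raddfB /= bc bdU /bds raddf0 subr0 subrr.
  have := pairing_delta b (@thC u) w2.
  rewrite db pairing0 bw raddfB /= => /esym/subr0_eq ->.
  by rewrite pairingU s0 /= cmpA.
apply: sections_eq => t; rewrite gE; apply: coind_eq => u tu.
by rewrite stE // coind_section // key g'b.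
Qed.

End Coinduced.
End Pullback.

(** * Sheaf cohomology as cohomology of cochains *)

Section Comparison.
Variables (V : abelianCat) (ei : enough_injectives V).
Context {d d' : Order.disp_t} {S : finPOrderType d} {Q : finPOrderType d'}.
Variables (j : Q -> S) (jh : forall x y, (x <= y)%O -> (j x <= j y)%O).
Hypothesis bj : forall u, bounding (fun x => (j x <= u)%O).
Local Notation ShS := (sheaf_preadditive S V).
Local Notation pull := (pullback jh).

(** The map into the coinduced sheaf with identity components is mono on stalks, hence splits by
    injectivity. *)
Lemma injective_summand (I : ShS) : injective_object I ->
  exists (i : hom I (coind (stalk I))) (r : hom (coind (stalk I)) I),
    r \oc i = idm I.
Proof.
move=> iI; have [i iE] := coind_hom_ex (fun u => idm (I u)).
have im : @mono (sheaf_preadditive S V) _ _ i.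
  apply/smonoP => u Z v w vw; rewrite -(cmp1m v) -(cmp1m w) -(iE u).
  by rewrite -!cmpA vw.
by have [r rE] := iI _ _ i im (idm I); exists i, r.
Qed.

Lemma pullback_mapM (F G H : ShS) (g : hom G H) (f : hom F G) :
  pullback_map jh g \oc pullback_map jh f = pullback_map jh (g \oc f).
Proof. by apply: sheaf_homP. Qed.

Lemma pullback_map1 (F : ShS) : pullback_map jh (idm F) = idm (pull F).
Proof. by apply: sheaf_homP. Qed.

Lemma pullback_injective_acyclic (I : ShS) : injective_object I ->
  acyclic (pull I).
Proof.
move=> /injective_summand[i [r ri]].
apply: (@acyclic_retract _ _ _ _ _ (pullback_map jh i) (pullback_map jh r)).
  by rewrite pullback_mapM ri pullback_map1.
exact: pullback_coind_acyclic.
Qed.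

(** The kernel property passes from the coinduced sheaf to its retract [I]. *)
Lemma sections_cochain_injective (I : ShS) : injective_object I ->
  is_kernel (delta (pull I) 0) (sections_cochain jh I).
Proof.
move=> /injective_summand[i [r ri]].
have gK := @sections_cochain_coind _ _ _ _ V j jh (stalk I) bj.
have si : sections_map r \oc sections_map i = idm _.
  by rewrite -[RHS](fmap1 (global_sections S V)) -ri [RHS]fmapM.
split=> [|Z b db]; first exact: delta_sections_cochain.
have [|g [gE _]] := gK.2 Z (cmap 0 (pullback_map jh i) \oc b).
  by rewrite cmpA cmap_delta -cmpA db cmpm0.
exists (sections_map r \oc g); split=> [|g' g'E].
  rewrite cmpA sections_cochain_map -cmpA gE cmpA cmapM pullback_mapM ri.
  by apply: cch_eq => x s _; rewrite cmpA cmapE; congr (_ \oc _); exact: cmp1m.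
have -> : g = sections_map i \oc g'.
  apply: (kernel_mono gK).
  by rewrite gE cmpA sections_cochain_map -cmpA g'E.
by rewrite cmpA si cmp1m.
Qed.

Lemma sheaf_exact_lift (A B C : ShS) (f : hom A B) (g : hom B C) x Z
    (z : hom Z (B x)) :
  exact f g -> sapp g x \oc z = 0 ->
  exists W (e : hom W Z) (w : hom W (A x)), epi e /\ sapp f x \oc w = z \oc e.
Proof.
move=> [K [k [u [gk ku eu]]]] gz.
have [v vE] := ker_lift_ex gz.
have [w [wE _]] := gk.2 _ _ (skermP g).1.
have [W [e [a [ee ue]]]] := epi_pullback (sapp w x \oc v) ((sepiP u).1 eu x).
exists W, e, a; split=> //.
have kw : sapp k x \oc sapp w x = kerm (sapp g x) := shomE x wE.
have fx : sapp k x \oc sapp u x = sapp f x := shomE x ku.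
by rewrite -vE -kw -fx -(cmpA (sapp k x)) ue !cmpA.
Qed.

(** An injective resolution on [S] pulls back to an acyclic resolution on [Q], and the sections over
    [S] of its terms are their degree 0 cocycles on [Q]. *)
Lemma sheaf_cohomology_pullback n (F : ShS) :
  isomorphic (sheaf_cohomology ei n F) (cohomology (cch_complex (pull F)) n).
Proof.
pose I := inj_resolution (sheaf_enough_injectives ei) (F : sheaf_abelian S V).
have augK x : is_kernel (sapp (cdiff I 0) (j x)) (sapp (ir_aug I) (j x)).
  apply: kernelP.
  - have im : mono (ir_aug I) by exact: ir_mono.
    exact: (proj1 (@smonoP _ S V F (I 0%N) (ir_aug I)) im (j x)).
  - exact: shomE (exact_cmp (ir_exact0 I)).
  - by move=> T t; exact: sheaf_exact_lift (ir_exact0 I).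
have iI m : @injective_object (sheaf_preadditive S V) (I m) :=
  @ir_inj _ _ I m.
have dd m : pullback_map jh (cdiff I m.+1) \oc pullback_map jh (cdiff I m) = 0.
  by apply: sheaf_homP => x; exact: (shomE (j x) (cdiffK I m)).
have exI m x Z (z : hom Z (pull (I m.+1) x)) :
    sapp (pullback_map jh (cdiff I m.+1)) x \oc z = 0 ->
    exists W (e : hom W Z) (w : hom W (pull (I m) x)),
      epi e /\ sapp (pullback_map jh (cdiff I m)) x \oc w = z \oc e.
  exact: sheaf_exact_lift (ir_exact I m).
pose A : acyclic_resolution (pull F) := @AcyclicResolution _ _ _ (pull F)
  (fun m => pull (I m)) (fun m => pullback_map jh (cdiff I m))
  (pullback_map jh (ir_aug I)) (fun m => pullback_injective_acyclic (@iI m))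
  augK dd exI.
pose X : sections_complex A := @SectionsComplex _ _ _ _ A
  (map_complex (global_sections S V) I) (fun m => sections_cochain jh (I m))
  (fun m => sections_cochain_injective (@iI m))
  (fun m => sections_cochain_map jh (cdiff I m)).
exact: (acyclic_resolution_cohomology X n).
Qed.

End Comparison.

Lemma pullback_id (d : Order.disp_t) (S : finPOrderType d) (V : abelianCat)
    (F : sheaf S V) :
  pullback (j := idfun) (fun x y h => h) F = F.
Proof. by case: F. Qed.

Theorem theorem1p14 (R : realType) (V : abelianCat) (ei : enough_injectives V)
    (d : Order.disp_t) (S : finPOrderType d) (F : sheaf S V) (s : S)
    (hs : has_homology_of_point R
            (poset_realization R (subposet [set v : S | (v < s)%O]%SET))) :
  forall j : nat,
    isomorphic (sheaf_cohomology ei j F)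
               (sheaf_cohomology ei j (restriction F [set~ s]%SET)).
Proof.
move=> n; pose Q := subposet [set~ s]%SET; pose G := restriction F [set~ s]%SET.
have bQ u : bounding (fun x : Q => (idfun x <= u)%O) by exact: bounding_top.
(* For [u] different from [s] the set has the top element [u]; for [u = s] the hypothesis on the
   strict lower set applies. *)
have bS u : bounding (fun x : Q => (val x <= u)%O).
  have [->|us] := eqVneq u s; first exact: bounding_below hs.
  have uQ : u \in [set~ s]%SET by rewrite !inE.
  exact: (@bounding_top _ Q (Subposet uQ)).
pose vh (x y : Q) (h : (x <= y)%O) : (val x <= val y)%O := h.
(* Both sides are identified with the cohomology of the cochains on [Q]: the left one along the
   inclusion into [S], the right one along the identity of [Q]. *)
apply: isomorphic_trans (sheaf_cohomology_pullback ei vh bS n F) _.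
apply: isomorphic_sym.
have -> : pullback vh F = G by [].
rewrite -[X in cch_complex X]pullback_id.
exact: (sheaf_cohomology_pullback ei _ bQ n G).
Qed.
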